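(* Let $\nu$ be a probability on $\mathbb T$ such that $P_\nu$ is hyperbounded. Then for every sequence of distinct positive integers $(n_k)_{k\ge1}$ with bounded gaps (i.e. $\sup_{k\ge1}|n_{k+1}-n_k|<\infty$), the sequence $(n_kx)_{k\ge1}$ is uniformly distributed modulo 1 for $\nu$-almost every $x$.
   Context: Here $\mathbb T$ is the circle group identified with $[0,1)$ (addition modulo 1), with Lebesgue measure $\mu$; $L^p=L^p(\mathbb T,\mu)$. For a probability $\nu$ on $\mathbb T$, $P_\nu f(x)=\int_{\mathbb T}f(x-y)\,d\nu(y)$, which is a contraction of every $L^p$. $P_\nu$ is hyperbounded if it maps $L^p$ into $L^q$ for some $1<p<q\le\infty$. A real sequence $(x_k)_{k\ge1}$ is uniformly distributed modulo 1 if for all $0\le a<b\le1$, $\lim_{N\to\infty}\frac1N\sum_{k=1}^N1_{[a,b)}(\{x_k\})=b-a$, where $\{x\}=x-[x]$ is the fractional part. *)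

(* Defs.v *)
From HB Require Import structures.
From mathcomp Require Import all_boot all_order all_algebra.
From mathcomp Require Import all_classical all_reals all_analysis.
From mathcomp Require Import measurable_realfun.

Set Implicit Arguments.
Unset Strict Implicit.
Unset Printing Implicit Defensive.

Import Order.TTheory GRing.Theory Num.Theory.
Import numFieldNormedType.Exports.

Local Open Scope classical_set_scope.
Local Open Scope ring_scope.

Definition frac_part (R : realType) (x : R) : R := x - (Num.floor x)%:~R.

Lemma frac_part_itv (R : realType) (x : R) : 0 <= frac_part x < 1.
Proof.
by rewrite /frac_part subr_ge0 floor_le ltrBlDr addrC -(intrD _ _ 1) floorD1_gt.
Qed.

Lemma frac_partDz (R : realType) (x : R) (m : int) : frac_part (x + m%:~R) = frac_part x.
Proof.
rewrite /frac_part floorDrz ?intr_int// intrKfloor intrD.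
by rewrite opprD addrACA subrr addr0.
Qed.

Record circle (R : realType) := Circle {
  circle_val : R;
  circle_valP : 0 <= circle_val < 1
}.

HB.instance Definition _ (R : realType) := [isSub for @circle_val R].
HB.instance Definition _ (R : realType) := [Choice of circle R by <:].

Definition to_circle (R : realType) (x : R) : circle R := Circle (frac_part_itv x).

Section circle_group.
Variable R : realType.
Implicit Types x y z : circle R.

Definition circle_zero : circle R := to_circle 0.
Definition circle_opp x : circle R := to_circle (- circle_val x).
Definition circle_add x y : circle R :=
  to_circle (circle_val x + circle_val y).

Lemma to_circleDz (a : R) (m : int) : to_circle (a + m%:~R) = to_circle a.
Proof. by apply: val_inj; exact: frac_partDz. Qed.

Lemma to_circleDl (a b : R) :
  to_circle (circle_val (to_circle a) + b) = to_circle (a + b).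
Proof. by rewrite /= /frac_part addrAC -mulrNz to_circleDz. Qed.

Lemma to_circleK : cancel (@circle_val R) (@to_circle R).
Proof.
move=> x; apply: val_inj; rewrite /= /frac_part.
have -> : Num.floor (circle_val x) = 0.
  by apply: floor_def; rewrite add0r; exact: circle_valP.
by rewrite subr0.
Qed.

Lemma circle_addA : associative circle_add.
Proof.
move=> x y z; rewrite /circle_add to_circleDl addrC to_circleDl.
by rewrite addrC addrA.
Qed.

Lemma circle_addC : commutative circle_add.
Proof. by move=> x y; rewrite /circle_add addrC. Qed.

Lemma circle_add0 : left_id circle_zero circle_add.
Proof. by move=> x; rewrite /circle_add to_circleDl add0r to_circleK. Qed.

Lemma circle_addN : left_inverse circle_zero circle_opp circle_add.
Proof. by move=> x; rewrite /circle_add to_circleDl addNr. Qed.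

End circle_group.

HB.instance Definition _ (R : realType) := GRing.isZmodule.Build (circle R)
  (@circle_addA R) (@circle_addC R) (@circle_add0 R) (@circle_addN R).
HB.instance Definition _ (R : realType) :=
  isPointed.Build (circle R) (0 : circle R).

(* The sigma-algebra is the trace on [0, 1) of the Borel sets of the line;
   it coincides with the Borel sigma-algebra of the topological group R/Z. *)
HB.instance Definition _ (R : realType) := Measurable.copy (circle R)
  (g_sigma_algebra_preimageType
    (@circle_val R : circle R -> measurableTypeR R)).

Lemma measurable_to_circle (R : realType) :
  measurable_fun [set: measurableTypeR R]
    (@to_circle R : measurableTypeR R -> circle R).
Proof.
move=> _ _ [B mB <-]; rewrite !setTI.
have mfrac_part : measurable_fun [set: R] (@frac_part R).
  apply: measurable_funB => //.
  apply: nondecreasing_measurable => // x y xy.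
  by rewrite ler_int; exact: le_floor.
have := mfrac_part measurableT B mB; rewrite setTI; exact.
Qed.

Definition circle_measure (R : realType) : set (circle R) -> \bar R :=
  pushforward (mrestr (@lebesgue_measure R) (measurable_itv `[0, 1[))
    (@to_circle R : measurableTypeR R -> circle R).

Section circle_measure_is_probability.
Variable R : realType.

HB.instance Definition _ := Measure.copy (@circle_measure R)
  (measure_function_pushforward__canonical__measure_function_Measure
    (mrestr (@lebesgue_measure R) (measurable_itv `[0, 1[))
    (@measurable_to_circle R)).

Let circle_measureT : @circle_measure R [set: circle R] = 1%E.
Proof.
rewrite /circle_measure /pushforward preimage_setT /mrestr setTI.
by rewrite lebesgue_measure_itv/= lte_fin ltr01 oppr0 adde0.
Qed.

HB.instance Definition _ :=
  Measure_isProbability.Build _ _ _ (@circle_measure R) circle_measureT.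

End circle_measure_is_probability.

Definition convolution_op (R : realType) (nu : probability (circle R) R)
    (f : circle R -> R) : circle R -> R :=
  fun x => \int[nu]_y f (x - y).

(* Lfun mu p consists of the real-valued Borel functions with finite L^p norm.
   Since convolution commutes with real and imaginary parts, mapping real L^p into
   real L^q is the same as mapping complex L^p into complex L^q.  The integral
   defining convolution_op nu f x converges for almost every x when f is in L^p; the
   value Rintegral takes elsewhere does not affect membership in L^q. *)
Definition hyperbounded (R : realType) (nu : probability (circle R) R) :=
  exists p q : \bar R, [/\ (1 < p)%E, (p < q)%E &
    forall f : circle R -> R,
      f \in Lfun (@circle_measure R) p ->
      convolution_op nu f \in Lfun (@circle_measure R) q].

(* Sequences are indexed from 0: u k is the (k+1)-st term, so the sum runs over
   the first N terms. *)
Definition unif_dist_mod1 (R : realType) (u : nat -> R) :=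
  forall a b : R, 0 <= a -> a < b -> b <= 1 ->
    (fun N : nat => N%:R^-1 * \sum_(k < N) \1_(`[a, b[) (frac_part (u k)))
      @ \oo --> b - a.

(* Main.v *)
(* If P_nu maps L^p into L^q with 1 < p < q, apply it to the function
   t |-> t^(-a) on [0, 1) with 1/q < a < 1/p, which lies in L^p.  Its image is
   at least (2 r)^(-a) nu(I) on an arc of length r when I is an arc of length r,
   so integrability of the q-th power gives nu(I) <= C r^(a - 1/q): nu is Hoelder
   continuous on arcs, and no closed graph argument is needed.

   Write T_N(x) = sum_(k < N) e(n_k x).  Since the n_k are distinct and n_k = O(k),
   the integral of |T_N|^2 against nu is O(N sum_(l < D) |nu^(l)|) with D = O(N).
   The sum of |nu^(l)|^2 over l < D is the double integral of a Dirichlet kernel,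
   and the Hoelder condition bounds it by D^(1 - epsilon).  Hence the integrals of
   |T_N / N|^2 are summable along N = j^s for s large, so T_N / N tends to 0
   nu-almost everywhere along this subsequence, and then along all N since
   (j + 1)^s / j^s tends to 1.  Replacing n_k by m n_k handles every frequency m,
   and Weyl's criterion concludes. *)

Require Import Defs.
From mathcomp Require Import all_boot all_order all_algebra.
From mathcomp Require Import all_classical all_reals all_analysis.
From mathcomp Require Import measurable_realfun ring lra zify.

Import Order.TTheory GRing.Theory Num.Theory.
Import numFieldNormedType.Exports.

Local Open Scope classical_set_scope.
Local Open Scope ring_scope.

(** * Dirichlet and Fejer kernels *)

(** Telescoping: [2 sin t cos (2jt) = sin ((2j+1)t) - sin ((2j-1)t)]. Keeping [sin t] as a factor
    avoids dividing by zero. *)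
Lemma dirichlet_cos (R : realType) (t : R) n :
  2 * sin t * (\sum_(j < n) cos (j%:R * (2 * t))) = sin (2 * n%:R * t - t) + sin t.
Proof.
elim: n => [|n IHn]; first by rewrite big_ord0 !mulr0 mul0r sub0r sinN addNr.
rewrite big_ord_recr /= mulrDr IHn.
have -> : 2 * n.+1%:R * t - t = n%:R * (2 * t) + t by rewrite -natr1; ring.
have -> : 2 * n%:R * t - t = n%:R * (2 * t) - t by ring.
by rewrite sinB sinD; ring.
Qed.

Lemma dirichlet_sin (R : realType) (t : R) n :
  2 * sin t * (\sum_(j < n) sin (j%:R * (2 * t))) = cos t - cos (2 * n%:R * t - t).
Proof.
elim: n => [|n IHn]; first by rewrite big_ord0 !mulr0 mul0r sub0r cosN subrr.
rewrite big_ord_recr /= mulrDr IHn.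
have -> : 2 * n.+1%:R * t - t = n%:R * (2 * t) + t by rewrite -natr1; ring.
have -> : 2 * n%:R * t - t = n%:R * (2 * t) - t by ring.
by rewrite cosB cosD; ring.
Qed.

(** Cancellation in the real part of the Dirichlet kernel at angle [2t]: it is at most
    [1 / |sin t|], uniformly in [n], wherever [sin t] is nonzero. *)
Lemma normr_dirichlet_cos (R : realType) (t : R) n :
  `|sin t| * `|\sum_(j < n) cos (j%:R * (2 * t))| <= 1.
Proof.
have := congr1 Num.norm (dirichlet_cos _ t n).
rewrite !normrM (ger0_norm (_ : 0 <= 2))// -mulrA => e.
have := ler_normD (sin (2 * n%:R * t - t)) (sin t).
have := sin_max (2 * n%:R * t - t); have := sin_max t; lra.
Qed.

Lemma normr_dirichlet_sin (R : realType) (t : R) n :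
  `|sin t| * `|\sum_(j < n) sin (j%:R * (2 * t))| <= 1.
Proof.
have := congr1 Num.norm (dirichlet_sin _ t n).
rewrite !normrM (ger0_norm (_ : 0 <= 2))// -mulrA => e.
have := ler_normB (cos t) (cos (2 * n%:R * t - t)).
have := cos_max (2 * n%:R * t - t); have := cos_max t; lra.
Qed.

(** A weak Jordan inequality. Up to [1/4] it follows from the mean value theorem, since [pi >= 2]
    and the cosine is at least [1/2] on [[0, pi/4]]; beyond, monotonicity gives
    [sin (pi t) >= sin (pi/4) >= 1/2]. *)
Lemma sin_pi_ge (R : realType) (t : R) : 0 <= t <= 2^-1 -> t <= sin (pi * t).
Proof.
move=> /andP[t0 t2].
have pi0 : 0 < pi :> R := pi_gt0 R.
have pi2 : 2 <= pi :> R := pi_ge2 R.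
have pt2 : pi * t <= pi / 2 by rewrite ler_pM2l.
have c4 : 2^-1 <= cos (pi / 4) :> R.
  have := cos_mulr2n (pi / 4 : R).
  have -> : pi / 4 *+ 2 = pi / 2 :> R by rewrite -mulr_natl; field.
  rewrite cos_pihalf.
  have : 0 <= cos (pi / 4) :> R by apply: cos_ge0_pihalf; lra.
  by move=> c0 e; rewrite -ler_sqr ?nnegrE//; rewrite -mulr_natr in e; lra.
have [t4|t4] := leP t 4^-1.
  have pt0 : 0 <= pi * t by rewrite mulr_ge0// ltW.
  have pt4 : pi * t <= pi / 4 by rewrite ler_pM2l.
  have [] := @MVT_segment R sin cos 0 (pi * t) pt0.
    by apply: continuous_subspaceT => x; exact: continuous_sin.
  move=> c; rewrite in_itv/= => /andP[c0 cpt]; rewrite sin0 !subr0 => ->.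
  have cc : cos (pi / 4) <= cos c.
    by rewrite leNgt ltr_cos ?in_itv/= -?leNgt; lra.
  apply: (@le_trans _ _ (2^-1 * (2 * t))); first lra.
  by apply: ler_pM; rewrite ?mulr_ge0 ?ler_wpM2r//; lra.
have s4 : 2^-1 <= sin (pi / 4) :> R.
  rewrite (_ : pi / 4 = pi / 2 - pi / 4); last by field.
  by rewrite sinB sin_pihalf cos_pihalf mul1r mul0r subr0.
rewrite (le_trans t2)// (le_trans s4)// leNgt ltr_sin ?in_itv/= -?leNgt.
- by rewrite ler_pM2l// ltW.
- by apply/andP; split; [apply: le_trans (mulr_ge0 _ _); lra|].
- by lra.
Qed.

(** Parity and the reflection [t -> 1 - t] reduce this to [[0, 1/2]]. The hypothesis is a distance
    of at least [r] from the integers. *)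
Lemma normr_sin_pi_ge (R : realType) (r t : R) :
  r <= `|t| <= 1 - r -> r <= `|sin (pi * t)|.
Proof.
wlog t0 : t / 0 <= t.
  move=> H; have [/H//|/ltW t0 rt] := leP 0 t.
  have := H (- t); rewrite oppr_ge0 t0 normrN mulrN sinN normrN; exact.
rewrite ger0_norm// => /andP[rt tr].
have [t2|t2] := leP t 2^-1.
  by rewrite (le_trans rt)// (le_trans _ (ler_norm _))// sin_pi_ge// t0.
have [r0|r0] := leP r 0; first exact: (le_trans r0).
have <- : sin (pi * (1 - t)) = sin (pi * t).
  by rewrite mulrBr mulr1 sinB sinpi cospi; ring.
apply: (le_trans _ (ler_norm _)); apply: (@le_trans _ _ (1 - t)); first lra.
by apply: sin_pi_ge; apply/andP; split; lra.
Qed.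

(** The Fejer kernel, the squared modulus of the sum of [e^(ijt)] for [j < M] divided by [M], in
    real form. *)
Definition fejer {R : realType} (M : nat) (t : R) : R :=
  M%:R^-1 * ((\sum_(j < M) cos (j%:R * t)) ^+ 2 + (\sum_(j < M) sin (j%:R * t)) ^+ 2).

Lemma sum_cos_sqr (R : realType) N (u : nat -> R) :
  (\sum_(j < N) cos (u j)) ^+ 2 + (\sum_(j < N) sin (u j)) ^+ 2 =
  \sum_(j < N) \sum_(k < N) cos (u j - u k).
Proof.
rewrite !expr2 !mulr_suml -big_split /=; apply: eq_bigr => j _.
rewrite !mulr_sumr -big_split /=; apply: eq_bigr => k _.
by rewrite cosB.
Qed.

Lemma fejerE (R : realType) M (t : R) :
  fejer M t = M%:R^-1 * \sum_(j < M) \sum_(k < M) cos ((j%:R - k%:R) * t).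
Proof.
rewrite /fejer (sum_cos_sqr _ _ (fun j => j%:R * t)).
by congr (_ * _); do 2!apply: eq_bigr => ? _; rewrite mulrBl.
Qed.

Lemma fejer_ge0 (R : realType) M (t : R) : 0 <= fejer M t.
Proof. by rewrite mulr_ge0// addr_ge0// sqr_ge0. Qed.

(** The Dirichlet bounds at the half angle make each squared sum at most [1 / r^2]. *)
Lemma fejer_le (R : realType) M (r t : R) : 0 < r -> r <= `|sin (t / 2)| ->
  fejer M t <= 2 / (M%:R * r ^+ 2).
Proof.
move=> r0 rt; rewrite /fejer invfM mulrCA; apply: ler_wpM2l => //.
have -> : t = 2 * (t / 2) by field.
have := normr_dirichlet_cos _ (t / 2) M.
have := normr_dirichlet_sin _ (t / 2) M.
set S := \sum_(_ < _) sin _; set C := \sum_(_ < _) cos _ => hS hC.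
have sq x : `|sin (t / 2)| * `|x| <= 1 -> x ^+ 2 <= (r ^+ 2)^-1 :> R.
  move=> hx; rewrite -[leLHS]real_normK ?num_real// -exprVn.
  rewrite ler_sqr ?nnegrE ?invr_ge0 ?(ltW r0)// -(ler_pM2l r0) mulfV ?gt_eqF//.
  by apply: le_trans hx; apply: ler_wpM2r.
by rewrite mulr_natl mulr2n; apply: lerD; apply: sq.
Qed.

(** A whole number of periods is a difference of two naturals, so periodicity in natural multiples
    is used once on each side. *)
Lemma sinD2piz (R : realType) (x : R) (j k : nat) :
  sin (x + 2 * pi * (j%:R - k%:R)) = sin x.
Proof.
rewrite -[LHS](periodicn (@sinD2pi R) k) -[RHS](periodicn (@sinD2pi R) j).
by congr sin; rewrite -[pi *+ 2]mulr_natl -[_ *+ k]mulr_natl -[_ *+ j]mulr_natl; ring.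
Qed.

Lemma cosD2piz (R : realType) (x : R) (j k : nat) :
  cos (x + 2 * pi * (j%:R - k%:R)) = cos x.
Proof.
rewrite -[LHS](periodicn (@cosD2pi R) k) -[RHS](periodicn (@cosD2pi R) j).
by congr cos; rewrite -[pi *+ 2]mulr_natl -[_ *+ k]mulr_natl -[_ *+ j]mulr_natl; ring.
Qed.

(** Orthogonality of the characters of Z/Q on a translated grid; indices below [Q] keep [j - k] from
    being a nonzero multiple of [Q]. *)
Lemma sum_grid_cos (R : realType) Q (j k : 'I_Q) (s : R) :
  \sum_(r < Q) cos ((j%:R - k%:R) * (s - 2 * pi * (r%:R / Q%:R))) = Q%:R * (j == k)%:R.
Proof.
have [->|jk] := eqVneq j k.
  under eq_bigr do rewrite subrr mul0r cos0.
  by rewrite sumr_const card_ord mulr1.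
rewrite mulr0.
have Q0 : 0 < Q%:R :> R by rewrite ltr0n; apply: leq_ltn_trans (ltn_ord j).
(* Consecutive grid terms differ by the angle [2t], and [sin t] is nonzero since [0 < |m| < Q]. *)
set m : R := j%:R - k%:R; pose t := pi * (m / Q%:R).
have st : sin t != 0.
  have m0 : 0 < `|m|.
    by rewrite normr_gt0 subr_eq0 eqr_nat.
  have mQ : `|m| < Q%:R.
    have := ltn_ord j; have := ltn_ord k; rewrite -!(ltr_nat R).
    have : 0 <= j%:R :> R by []. have : 0 <= k%:R :> R by [].
    by rewrite /m => *; rewrite ltr_norml; apply/andP; split; lra.
  rewrite -normr_gt0 /t.
  have mQ0 : 0 < `|m| / Q%:R < 1 by rewrite divr_gt0//= ltr_pdivrMr// mul1r.
  apply: (@lt_le_trans _ _ (Num.min (`|m| / Q%:R) (1 - `|m| / Q%:R))).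
    by rewrite lt_min subr_gt0; lra.
  apply: normr_sin_pi_ge; rewrite normrM normfV (ger0_norm (ltW Q0)).
  by rewrite ge_min lexx/= lerBrDl -lerBrDr ge_min lexx orbT.
have hc : \sum_(r < Q) cos (r%:R * (2 * t)) = 0.
  apply: (mulfI (_ : 2 * sin t != 0)); first by rewrite mulf_neq0.
  rewrite dirichlet_cos mulr0.
  (* [2Qt] is a whole number of periods, so the closed form collapses to [sin (- t) + sin t]. *)
  have -> : 2 * Q%:R * t - t = - t + 2 * pi * (j%:R - k%:R).
    by rewrite /t /m; field; rewrite gt_eqF.
  by rewrite sinD2piz sinN addNr.
have hs : \sum_(r < Q) sin (r%:R * (2 * t)) = 0.
  apply: (mulfI (_ : 2 * sin t != 0)); first by rewrite mulf_neq0.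
  rewrite dirichlet_sin mulr0.
  have -> : 2 * Q%:R * t - t = - t + 2 * pi * (j%:R - k%:R).
    by rewrite /t /m; field; rewrite gt_eqF.
  by rewrite cosD2piz cosN subrr.
rewrite (eq_bigr (fun r : 'I_Q => cos (m * s) * cos (r%:R * (2 * t)) +
                          sin (m * s) * sin (r%:R * (2 * t)))); last first.
  move=> r _; rewrite -cosB; congr cos; rewrite /t.
  by field; rewrite gt_eqF.
by rewrite big_split /= -!mulr_sumr hc hs !mulr0 addr0.
Qed.

(** Orthogonality leaves only the diagonal. The grid translates of the kernel thus add up to a
    constant, which is what builds a trigonometric majorant of an indicator. *)
Lemma sum_grid_fejer (R : realType) Q (s : R) : (0 < Q)%N ->
  \sum_(r < Q) fejer Q (s - 2 * pi * (r%:R / Q%:R)) = Q%:R.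
Proof.
move=> Q0; under eq_bigr do rewrite fejerE.
rewrite -mulr_sumr exchange_big /=.
rewrite (eq_bigr (fun=> Q%:R)); first last.
  move=> j _; rewrite exchange_big /=.
  under eq_bigr do rewrite sum_grid_cos.
  rewrite -mulr_sumr (bigD1 j)//= eqxx big1 ?addr0 ?mulr1// => k.
  by rewrite eq_sym => /negbTE ->.
by rewrite sumr_const card_ord -(mulr_natl Q%:R) mulKf// pnatr_eq0 -lt0n.
Qed.

Lemma count_itv_le (R : realType) (x y : R) n : x <= y + 1 ->
  \sum_(r < n) ((x <= r%:R <= y)%R)%:R <= y - x + 1 :> R.
Proof.
move=> xy.
(* The induction needs a bound depending on [n]: the disjoint unit intervals starting at the counted
   [r] lie between [x] and [min n (y + 1)]. *)
suff H : \sum_(r < n) ((x <= r%:R <= y)%R)%:R <= Num.max 0 (Num.min n%:R (y + 1) - x).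
  apply: (le_trans H); rewrite ge_max; apply/andP; split; first lra.
  by rewrite addrAC lerB// ge_min lexx orbT.
elim: n => [|n IHn]; first by rewrite big_ord0 le_max lexx.
rewrite big_ord_recr /=; have [/andP[xn ny]|_] := boolP (_ <= _ <= _).
  have nn1 : n%:R + 1 = n.+1%:R :> R by rewrite natr1.
  apply: (@le_trans _ _ (n%:R - x + 1)).
    rewrite lerD2r (le_trans IHn)// ge_max subr_ge0 xn/=.
    by rewrite lerB// ge_min lexx.
  rewrite le_max; apply/orP; right; rewrite addrAC lerB// le_min nn1 lexx/=.
  by rewrite -nn1 lerD2r.
rewrite addr0 (le_trans IHn)// ge_max le_max lexx /= le_max.
apply/orP; right; rewrite lerB// le_min !ge_min lexx orbT andbT.
by rewrite ler_nat leqnSn.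
Qed.

(** * Weyl's criterion *)

(* The grid points r / Q within eta of [a, b), or of 0 or 1: including the latter
   makes the condition insensitive to wrapping around the circle. *)
Definition near_grid {R : realType} (Q : nat) (eta a b : R) (r : nat) : bool :=
  [|| (0 <= (r%:R : R) <= Q%:R * eta)%R, (Q%:R * (1 - eta) <= (r%:R : R) <= Q%:R)%R
    | (Q%:R * (a - eta) <= r%:R <= Q%:R * (b + eta))%R].

(** Three intervals are counted, of lengths [Q eta], [Q eta] and [Q (b - a + 2 eta)], each with an
    error of 1. *)
Lemma sum_near_grid_le (R : realType) Q (eta a b : R) : 0 < eta -> a <= b ->
  \sum_(r < Q) (near_grid Q eta a b r)%:R <= Q%:R * (b - a + 4 * eta) + 3.
Proof.
move=> eta0 ab; have Q0 : 0 <= Q%:R :> R by [].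
have Qe : 0 <= Q%:R * eta by rewrite mulr_ge0// ltW.
have Qab : 0 <= Q%:R * (b - a) by rewrite mulr_ge0// subr_ge0.
apply: (@le_trans _ _ (\sum_(r < Q) ((0 <= (r%:R : R) <= Q%:R * eta)%R%:R
    + (Q%:R * (1 - eta) <= (r%:R : R) <= Q%:R)%R%:R
    + (Q%:R * (a - eta) <= r%:R <= Q%:R * (b + eta))%R%:R))).
  apply: ler_sum => r _; rewrite /near_grid -!natrD ler_nat.
  by do 3!case: (_ <= _ <= _)%R.
rewrite !big_split/=.
have := @count_itv_le R 0 (Q%:R * eta) Q.
have := @count_itv_le R (Q%:R * (1 - eta)) Q%:R Q.
have := @count_itv_le R (Q%:R * (a - eta)) (Q%:R * (b + eta)) Q.
set S1 := \sum_(_ < _) _; set S2 := \sum_(_ < _) _; set S3 := \sum_(_ < _) _.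
move=> h1 h2 h3.
have := h1 ltac:(lra). have := h2 ltac:(lra). have := h3 ltac:(lra).
lra.
Qed.

(** For [s] in [[a, b)] the kernels at all grid points sum to [Q]. A grid point that is not near is
    at distance at least [eta] from [s] on the circle, so its kernel is at most [2 / (Q eta^2)], and
    there are at most [Q] of those. *)
Lemma indic_le_fejer (R : realType) Q (eta a b s : R) :
  (0 < Q)%N -> 0 < eta -> 0 <= s < 1 ->
  \1_(`[a, b[) s <= 2 / (Q%:R * eta ^+ 2) + Q%:R^-1 * \sum_(r < Q)
    (near_grid Q eta a b r)%:R * fejer Q (2 * pi * s - 2 * pi * (r%:R / Q%:R)).
Proof.
move=> Q0 eta0 /andP[s0 s1].
have Qp : 0 < Q%:R :> R by rewrite ltr0n.
have e0 : 0 <= 2 / (Q%:R * eta ^+ 2) by rewrite divr_ge0// mulr_ge0// sqr_ge0.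
rewrite indicE mem_setE in_itv/=; have [/andP[sa sb]|_] := boolP (_ <= _ < _); last first.
  by rewrite addr_ge0// mulr_ge0// sumr_ge0// => r _; rewrite mulr_ge0// fejer_ge0.
rewrite -(ler_pM2l Qp) mulr1 mulrDr mulVKf ?gt_eqF//.
rewrite -{1}(@sum_grid_fejer R Q (2 * pi * s) Q0) -lerBlDr -sumrB.
apply: (@le_trans _ _ (\sum_(r < Q) (2 / (Q%:R * eta ^+ 2)))); last first.
  by rewrite sumr_const card_ord -[leLHS](mulr_natl _ Q).
apply: ler_sum => r _; rewrite -{1}(mul1r (fejer _ _)) -mulrBl.
have [_|] := boolP (near_grid _ _ _ _ _); first by rewrite subrr mul0r.
rewrite subr0 mul1r !negb_or !negb_and -!ltNge ltrn0/= => /and3P[h1 h2 h3].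
apply: fejer_le => //.
rewrite (_ : (2 * pi * s - 2 * pi * (r%:R / Q%:R)) / 2 = pi * (s - r%:R / Q%:R)); last first.
  by field; rewrite gt_eqF.
apply: normr_sin_pi_ge.
have rQ : r%:R <= Q%:R :> R by rewrite ler_nat ltnW.
move: h2 h3; rewrite (ltNge _ r%:R) rQ orbF.
move: h1; rewrite -!(ltr_pdivlMl _ _ Qp) -!(ltr_pdivrMl _ _ Qp) ![Q%:R^-1 * _]mulrC.
move: (r%:R / Q%:R) => t h1 h2 /orP[h3|h3].
  by rewrite gtr0_norm; lra.
by rewrite ltr0_norm; lra.
Qed.

Definition avg {R : realType} (u : nat -> R) (N : nat) : R :=
  N%:R^-1 * \sum_(k < N) u k.

Lemma avgD (R : realType) (u v : nat -> R) N :
  avg (fun k => u k + v k) N = avg u N + avg v N.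
Proof. by rewrite /avg big_split/= mulrDr. Qed.

Lemma avgZ (R : realType) (c : R) (u : nat -> R) N :
  avg (fun k => c * u k) N = c * avg u N.
Proof. by rewrite /avg -mulr_sumr mulrCA. Qed.

Lemma avg_sum (R : realType) Q (u : 'I_Q -> nat -> R) N :
  avg (fun k => \sum_(r < Q) u r k) N = \sum_(r < Q) avg (u r) N.
Proof. by rewrite /avg exchange_big/= mulr_sumr. Qed.

Lemma avg_cst (R : realType) (c : R) N : (0 < N)%N -> avg (fun=> c) N = c.
Proof.
move=> N0; rewrite /avg sumr_const card_ord -(mulr_natl c) mulKf//.
by rewrite pnatr_eq0 -lt0n.
Qed.

Lemma ler_avg (R : realType) (u v : nat -> R) N :
  (forall k, u k <= v k) -> avg u N <= avg v N.
Proof. by move=> uv; rewrite /avg ler_wpM2l// ler_sum. Qed.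

Lemma cvg_avg_cst (R : realType) (c : R) : avg (fun=> c) @ \oo --> c.
Proof.
apply: cvg_near_cst; near=> N; apply: avg_cst.
by near: N; exact: nbhs_infty_gt.
Unshelve. all: by end_near. Qed.

(** Weyl's condition in real and imaginary parts; parity covers the negative frequencies. *)
Definition weyl_null {R : realType} (s : nat -> R) := forall m : nat, (0 < m)%N ->
  avg (fun k => cos (2 * pi * m%:R * s k)) @ \oo --> 0 /\
  avg (fun k => sin (2 * pi * m%:R * s k)) @ \oo --> 0.

(** Evenness of the cosine allows [j <= i], so that the frequency [i - j] is natural; the addition
    formula then removes the shift [x]. *)
Lemma cvg_avg_cos (R : realType) (s : nat -> R) (x : R) (i j : nat) :
  weyl_null s ->
  avg (fun k => cos ((i%:R - j%:R) * (2 * pi * s k - x))) @ \oo --> ((i == j)%:R : R).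
Proof.
move=> ws; wlog ij : i j / (j <= i)%N.
  move=> H; have /orP[/H//|/H] := leq_total j i.
  rewrite eq_sym; apply: cvg_trans; apply: near_eq_cvg; near=> N.
  rewrite /avg; congr (_ * _); apply: eq_bigr => k _.
  by rewrite -cosN -mulNr opprB.
have [->|nij] := eqVneq i j.
  rewrite (_ : (fun k => _) = fun=> 1); first exact: cvg_avg_cst.
  by apply/funext => k; rewrite subrr mul0r cos0.
have [c0 s0] := ws (i - j)%N ltac:(by rewrite subn_gt0 ltn_neqAle eq_sym nij).
have -> : avg (fun k => cos ((i%:R - j%:R) * (2 * pi * s k - x))) =
  (fun N => cos ((i%:R - j%:R) * x) * avg (fun k => cos (2 * pi * (i - j)%:R * s k)) N
   + sin ((i%:R - j%:R) * x) * avg (fun k => sin (2 * pi * (i - j)%:R * s k)) N).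
  apply/funext => N; rewrite -!avgZ -avgD /avg; congr (_ * _).
  apply: eq_bigr => k _; rewrite natrB// mulrBr cosB.
  by rewrite (_ : (i%:R - j%:R) * (2 * pi * s k) = 2 * pi * (i%:R - j%:R) * s k); ring.
rewrite [X in _ --> X](_ : _ = cos ((i%:R - j%:R) * x) * 0 +
  sin ((i%:R - j%:R) * x) * 0); last by rewrite !mulr0 addr0.
by apply: cvgD; apply: cvgMr.
Unshelve. all: by end_near. Qed.

Lemma cvg_bigsum (R : realType) Q (f : 'I_Q -> nat -> R) (l : 'I_Q -> R) :
  (forall r, f r @ \oo --> l r) ->
  (fun N => \sum_(r < Q) f r N) @ \oo --> \sum_(r < Q) l r.
Proof.
by move=> fl; apply: cvg_big => //; exact: add_continuous.
Qed.

Lemma cvg_avg_fejer (R : realType) (s : nat -> R) (x : R) Q : (0 < Q)%N ->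
  weyl_null s ->
  avg (fun k => fejer Q (2 * pi * s k - x)) @ \oo --> (1 : R).
Proof.
move=> Q0 ws.
have -> : avg (fun k => fejer Q (2 * pi * s k - x)) = (fun N => Q%:R^-1 *
  \sum_(i < Q) \sum_(j < Q) avg (fun k => cos ((i%:R - j%:R) * (2 * pi * s k - x))) N).
  apply/funext => N; under eq_bigr do rewrite -avg_sum.
  rewrite -avg_sum -avgZ; congr avg; apply/funext => k.
  by rewrite fejerE.
rewrite [X in _ --> X](_ : 1 = Q%:R^-1 * \sum_(i < Q) \sum_(j < Q) ((i == j)%:R : R)).
  apply: cvgMr; apply: (@cvg_bigsum R Q) => i; apply: (@cvg_bigsum R Q) => j.
  exact: cvg_avg_cos.
rewrite (eq_bigr (fun=> 1)); last first.
  move=> i _; rewrite (bigD1 i)//= eqxx big1 ?addr0// => j.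
  by rewrite eq_sym => /negbTE ->.
by rewrite sumr_const card_ord mulVf// pnatr_eq0 -lt0n.
Qed.

(** The indicator is replaced by its Fejer majorant, a trigonometric polynomial whose averages
    converge to its constant term. *)
Lemma weyl_upper (R : realType) (s : nat -> R) (a b e : R) :
  (forall k, 0 <= s k < 1) -> weyl_null s -> a <= b -> 0 < e ->
  \forall N \near \oo, avg (fun k => \1_(`[a, b[) (s k)) N <= b - a + e.
Proof.
move=> s01 ws ab e0.
(* The excess over [b - a] is [4 eta + 3/Q + 2/(Q eta^2)]; each of the three terms is at most [e/4],
   so the limit stays strictly below [b - a + e]. *)
pose eta := e / 16.
have eta0 : 0 < eta by rewrite /eta; lra.
have [Q Q0 hQ] : exists2 Q : nat, (0 < Q)%N &
    2 / (Q%:R * eta ^+ 2) <= e / 4 /\ 3 / Q%:R <= e / 4.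
  pose y := Num.max (8 / (eta ^+ 2 * e)) (12 / e).
  exists (Num.trunc y).+1 => //.
  have yQ : y < (Num.trunc y).+1%:R by rewrite truncnS_gt.
  have e2 : 0 < eta ^+ 2 by rewrite exprn_gt0.
  have : 0 < (Num.trunc y).+1%:R :> R by rewrite ltr0n.
  move: yQ; move: (_.+1%:R : R) => Q; rewrite gt_max => /andP[] + + Qp.
  rewrite !ltr_pdivrMr ?mulr_gt0// => h1 h2.
  by split; rewrite ler_pdivrMr ?mulr_gt0//; lra.
have Qp : 0 < Q%:R :> R by rewrite ltr0n.
pose g (r : 'I_Q) : nat -> R :=
  avg (fun k => fejer Q (2 * pi * s k - 2 * pi * (r%:R / Q%:R))).
pose J (r : 'I_Q) : R := (near_grid Q eta a b r)%:R.
have hg : (fun N => 2 / (Q%:R * eta ^+ 2) + Q%:R^-1 * \sum_(r < Q) J r * g r N) @ \oo -->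
    2 / (Q%:R * eta ^+ 2) + Q%:R^-1 * \sum_(r < Q) J r * 1.
  apply: cvgD; first exact: cvg_cst.
  apply: cvgMr; apply: (@cvg_bigsum R Q) => r; apply: cvgMr.
  exact: cvg_avg_fejer.
have lb : 2 / (Q%:R * eta ^+ 2) + Q%:R^-1 * \sum_(r < Q) J r * 1 < b - a + e.
  under eq_bigr do rewrite mulr1.
  have := @sum_near_grid_le R Q eta a b eta0 ab.
  rewrite -(ler_pM2l (_ : 0 < Q%:R^-1)) ?invr_gt0// mulrDr mulKf ?gt_eqF//.
  have etaE : eta = e / 16 by [].
  by case: hQ; rewrite /J; lra.
have hlt := cvgr_lt _ hg _ lb.
near=> N; apply: (@le_trans _ _ (2 / (Q%:R * eta ^+ 2) +
    Q%:R^-1 * \sum_(r < Q) J r * g r N)); last by apply/ltW; near: N; exact: hlt.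
have N0 : (0 < N)%N by near: N; exact: nbhs_infty_gt.
rewrite -{1}(@avg_cst R (2 / (Q%:R * eta ^+ 2)) N N0).
have -> : Q%:R^-1 * \sum_(r < Q) J r * g r N = avg (fun k => Q%:R^-1 * \sum_(r < Q)
    J r * fejer Q (2 * pi * s k - 2 * pi * (r%:R / Q%:R))) N.
  by rewrite avgZ avg_sum; congr (_ * _); apply: eq_bigr => r _; rewrite avgZ.
by rewrite -avgD; apply: ler_avg => k; exact: indic_le_fejer.
Unshelve. all: by end_near. Qed.

Lemma weyl_null_frac (R : realType) (u : nat -> R) :
  weyl_null u -> weyl_null (fun k => frac_part (u k)).
Proof.
move=> wu m m0; have [c0 s0] := wu m m0.
have e k : exists i j : nat, 2 * pi * m%:R * frac_part (u k) =
    2 * pi * m%:R * u k + 2 * pi * (i%:R - j%:R).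
  rewrite /frac_part; case: (Num.floor (u k)) => n.
    by exists 0%N, (m * n)%N; rewrite natrM -pmulrn; ring.
  by exists (m * n.+1)%N, 0%N; rewrite natrM NegzE mulrNz -pmulrn; ring.
split; [rewrite (_ : avg _ = avg (fun k => cos (2 * pi * m%:R * u k)))//
  |rewrite (_ : avg _ = avg (fun k => sin (2 * pi * m%:R * u k)))//];
  congr avg; apply/funext => k;
  by have [i [j ->]] := e k; rewrite ?cosD2piz ?sinD2piz.
Qed.

Lemma weyl_criterion (R : realType) (u : nat -> R) :
  weyl_null u -> unif_dist_mod1 u.
Proof.
move=> /weyl_null_frac wu a b a0 ab b1.
pose s k := frac_part (u k).
have s01 k : 0 <= s k < 1 := frac_part_itv (u k).
change (avg (fun k => \1_(`[a, b[) (s k)) @ \oo --> b - a).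
(* The lower bound for [a, b) follows from the upper bounds for [0, a) and [b, 1). *)
apply/cvgrPdist_le => e e0.
have e2 : 0 < e / 2 by lra.
have h1 := @weyl_upper R s _ _ _ s01 wu (ltW ab) e2.
have h2 := @weyl_upper R s _ _ _ s01 wu a0 e2.
have h3 := @weyl_upper R s _ _ _ s01 wu b1 e2.
near=> N.
have N0 : (0 < N)%N by near: N; exact: nbhs_infty_gt.
have : avg (fun k => \1_(`[a, b[) (s k)) N <= b - a + e / 2 by near: N.
have : avg (fun k => \1_(`[0, a[) (s k)) N <= a - 0 + e / 2 by near: N.
have : avg (fun k => \1_(`[b, 1[) (s k)) N <= 1 - b + e / 2 by near: N.
have : avg (fun k => \1_(`[0, a[) (s k)) N + avg (fun k => \1_(`[a, b[) (s k)) N +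
    avg (fun k => \1_(`[b, 1[) (s k)) N = 1 :> R.
  rewrite -!avgD -[RHS](@avg_cst R 1 N N0); congr avg; apply/funext => k.
  have /andP[sk0 sk1] := s01 k.
  rewrite !indicE !mem_setE !in_itv/= sk0 sk1 andbT/=.
  have [sa|sa] := ltP (s k) a.
    by rewrite [b <= s k]leNgt (lt_trans sa ab) /= addr0 addr0.
  by have [sb|sb] := ltP (s k) b; rewrite ?addr0 ?add0r.
rewrite ler_norml => *; apply/andP; split; lra.
Unshelve. all: by end_near. Qed.

(** * Fourier coefficients of a probability on the circle *)

Lemma circle_valB (R : realType) (x y : circle R) :
  circle_val (x - y) = frac_part (circle_val x - circle_val y).
Proof.
suff -> : x - y = to_circle (circle_val x - circle_val y) by [].
rewrite -[LHS]/(circle_add x (circle_opp y)) /circle_add addrC /circle_opp.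
by rewrite to_circleDl addrC.
Qed.

Lemma measurable_circle_val (R : realType) :
  measurable_fun [set: circle R] (@circle_val R : circle R -> R).
Proof. by move=> _ B mB; exists B. Qed.

Lemma measurable_frac_part (R : realType) : measurable_fun [set: R] (@frac_part R).
Proof.
apply: measurable_funB => //; apply: nondecreasing_measurable => // x y xy.
by rewrite ler_int; exact: le_floor.
Qed.

(** A class closed under sums and products and integrable for every probability, which settles all
    integrability conditions for trigonometric sums. *)
Definition bounded_mfun {R : realType} (f : circle R -> R) :=
  measurable_fun [set: circle R] f /\ exists M, forall x, `|f x| <= M.

Lemma bounded_mfun_integrable (R : realType) (nu : probability (circle R) R)
    (f : circle R -> R) : bounded_mfun f -> nu.-integrable setT (EFin \o f).
Proof.
move=> [mf [M fM]]; apply: measurable_bounded_integrable => //.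
  by apply: (le_lt_trans (probability_le1 nu measurableT)); exact: ltry.
exists M; split; first exact: num_real.
by move=> y My x _; exact: le_trans (fM x) (ltW My).
Qed.

Lemma bounded_mfun_cst (R : realType) (c : R) : bounded_mfun (fun=> c : R).
Proof. by split; [exact: measurable_cst|exists `|c|]. Qed.

Lemma bounded_mfunD (R : realType) (f g : circle R -> R) :
  bounded_mfun f -> bounded_mfun g -> bounded_mfun (fun x => f x + g x).
Proof.
move=> [mf [M fM]] [mg [L gL]]; split; first exact: measurable_funD.
by exists (M + L) => x; rewrite (le_trans (ler_normD _ _))// lerD.
Qed.

Lemma bounded_mfunM (R : realType) (f g : circle R -> R) :
  bounded_mfun f -> bounded_mfun g -> bounded_mfun (fun x => f x * g x).
Proof.
move=> [mf [M fM]] [mg [L gL]]; split; first exact: measurable_funM.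
by exists (M * L) => x; rewrite normrM ler_pM.
Qed.

Lemma bounded_mfun_sum (R : realType) I (s : seq I) (f : I -> circle R -> R) :
  (forall i, bounded_mfun (f i)) -> bounded_mfun (fun x => \sum_(i <- s) f i x).
Proof.
move=> bf; elim: s => [|i s IH].
  by under [X in bounded_mfun X]eq_fun do rewrite big_nil; exact: bounded_mfun_cst.
by under [X in bounded_mfun X]eq_fun do rewrite big_cons; exact: bounded_mfunD.
Qed.

Lemma bounded_mfun_cos (R : realType) (a b : R) :
  bounded_mfun (fun x => cos (a * circle_val x + b)).
Proof.
split; last by exists 1 => x; exact: cos_max.
apply: measurableT_comp; first exact: continuous_measurable_fun (@continuous_cos R).
apply: measurable_funD => //; apply: measurable_funM => //.
exact: measurable_circle_val.
Qed.

Lemma bounded_mfun_sin (R : realType) (a b : R) :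
  bounded_mfun (fun x => sin (a * circle_val x + b)).
Proof.
split; last by exists 1 => x; exact: sin_max.
apply: measurableT_comp; first exact: continuous_measurable_fun (@continuous_sin R).
apply: measurable_funD => //; apply: measurable_funM => //.
exact: measurable_circle_val.
Qed.

Lemma bounded_mfun_cos0 (R : realType) (a : R) : bounded_mfun (fun x => cos (a * circle_val x)).
Proof.
by have := @bounded_mfun_cos R a 0;
  under [X in bounded_mfun X -> _]eq_fun do rewrite addr0.
Qed.

Lemma bounded_mfun_sin0 (R : realType) (a : R) : bounded_mfun (fun x => sin (a * circle_val x)).
Proof.
by have := @bounded_mfun_sin R a 0;
  under [X in bounded_mfun X -> _]eq_fun do rewrite addr0.
Qed.

Lemma Rintegral_sum (R : realType) (nu : probability (circle R) R) I (s : seq I)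
    (f : I -> circle R -> R) : (forall i, bounded_mfun (f i)) ->
  \int[nu]_x (\sum_(i <- s) f i x) = \sum_(i <- s) \int[nu]_x (f i x).
Proof.
move=> bf; elim: s => [|i s IH].
  under eq_Rintegral do rewrite big_nil.
  by rewrite big_nil Rintegral_cst// mul0r.
under eq_Rintegral do rewrite big_cons.
rewrite RintegralD ?IH ?big_cons//; apply: bounded_mfun_integrable => //.
exact: bounded_mfun_sum.
Qed.

Lemma Rintegral_le (R : realType) (nu : probability (circle R) R)
    (f g : circle R -> R) : bounded_mfun f -> bounded_mfun g -> (forall x, f x <= g x) ->
  \int[nu]_x f x <= \int[nu]_x g x.
Proof.
by move=> bf bg fg; apply: le_Rintegral => //; exact: bounded_mfun_integrable.
Qed.

Lemma Rintegral_prob_cst (R : realType) (nu : probability (circle R) R) (c : R) :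
  \int[nu]_x c = c.
Proof.
by rewrite Rintegral_cst//= probability_setT mulr1.
Qed.

Definition fourier_cos {R : realType} (nu : probability (circle R) R) (l : nat) : R :=
  \int[nu]_x cos (2 * pi * l%:R * circle_val x).
Definition fourier_sin {R : realType} (nu : probability (circle R) R) (l : nat) : R :=
  \int[nu]_x sin (2 * pi * l%:R * circle_val x).

(** A two-sided neighbourhood of [x], cut out by the quantity that controls the Dirichlet kernel. *)
Definition sin_arc {R : realType} (r : R) (x : circle R) : set (circle R) :=
  [set y | `|sin (pi * circle_val (x - y))| < r].

Lemma measurable_circle_sub (R : realType) (x : circle R) :
  measurable_fun [set: circle R] (fun y => circle_val (x - y) : R).
Proof.
under [X in measurable_fun _ X]eq_fun do rewrite circle_valB.
apply: measurableT_comp; first exact: measurable_frac_part.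
by apply: measurable_funB => //; exact: measurable_circle_val.
Qed.

Lemma measurable_sin_arc (R : realType) (r : R) (x : circle R) : measurable (sin_arc r x).
Proof.
have mf : measurable_fun [set: circle R] (fun y => `|sin (pi * circle_val (x - y))| : R).
  apply: measurableT_comp => //.
  apply: measurableT_comp; first exact: continuous_measurable_fun (@continuous_sin R).
  by apply: measurable_funM => //; exact: measurable_circle_sub.
rewrite (_ : sin_arc r x = setT `&`
    (fun y => `|sin (pi * circle_val (x - y))| : R) @^-1` `]-oo, r[).
  exact: mf.
by rewrite setTI; apply/seteqP; split => y /=; rewrite in_itv.
Qed.

(** [sin (pi u)] has period 2, but its square [(1 - cos (2 pi u)) / 2] has period 1. *)
Lemma normr_sin_frac (R : realType) (u : R) : `|sin (pi * frac_part u)| = `|sin (pi * u)|.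
Proof.
suff : sin (pi * frac_part u) ^+ 2 = sin (pi * u) ^+ 2.
  by move=> /(congr1 Num.sqrt); rewrite !sqrtr_sqr.
have h (z : R) : sin (pi * z) ^+ 2 = (1 - cos (2 * pi * z)) / 2.
  rewrite (_ : 2 * pi * z = (pi * z) *+ 2); last by rewrite -mulr_natl; ring.
  by rewrite cos_mulr2n -mulr_natl cos2sin2; field.
rewrite !h; congr ((_ - _) / _).
have [i [j ->]] : exists i j : nat, 2 * pi * frac_part u = 2 * pi * u + 2 * pi * (i%:R - j%:R).
  rewrite /frac_part; case: (Num.floor u) => n.
    by exists 0%N, n; rewrite -pmulrn; ring.
  by exists n.+1, 0%N; rewrite NegzE mulrNz -pmulrn; ring.
by rewrite cosD2piz.
Qed.

(** The sum of [|nu^(l)|^2] is the double integral against [nu] of the real Dirichlet kernel [K].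
    Splitting at [sin_arc r x] bounds the inner integral for every [x], and [nu] has mass 1. *)
Lemma energy_le (R : realType) (nu : probability (circle R) R) (r c : R) D :
  0 < r -> (forall x, (nu (sin_arc r x) <= c%:E)%E) ->
  \sum_(l < D) (fourier_cos nu l ^+ 2 + fourier_sin nu l ^+ 2) <= D%:R * c + r^-1.
Proof.
move=> r0 nuc.
pose K (x y : circle R) : R :=
  \sum_(l < D) cos (l%:R * (2 * (pi * (circle_val x - circle_val y)))).
have KE x : (fun y => K x y) = (fun y => \sum_(l < D)
    (cos (2 * pi * l%:R * circle_val x) * cos (2 * pi * l%:R * circle_val y) +
     sin (2 * pi * l%:R * circle_val x) * sin (2 * pi * l%:R * circle_val y))).
  apply/funext => y; apply: eq_bigr => l _; rewrite -cosB; congr cos; ring.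
have b1 x (l : 'I_D) : bounded_mfun (fun y =>
    cos (2 * pi * l%:R * circle_val x) * cos (2 * pi * l%:R * circle_val y) : R).
  by apply: bounded_mfunM; [exact: bounded_mfun_cst|exact: bounded_mfun_cos0].
have b2 x (l : 'I_D) : bounded_mfun (fun y =>
    sin (2 * pi * l%:R * circle_val x) * sin (2 * pi * l%:R * circle_val y) : R).
  by apply: bounded_mfunM; [exact: bounded_mfun_cst|exact: bounded_mfun_sin0].
have bK x : bounded_mfun (fun y => K x y).
  by rewrite KE; apply: bounded_mfun_sum => l; exact: bounded_mfunD.
have intK x : \int[nu]_y K x y = \sum_(l < D)
    (fourier_cos nu l * cos (2 * pi * l%:R * circle_val x) +
     fourier_sin nu l * sin (2 * pi * l%:R * circle_val x)).
  rewrite KE Rintegral_sum; last by move=> l; exact: bounded_mfunD.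
  apply: eq_bigr => l _; rewrite RintegralD//; [|exact: bounded_mfun_integrable..].
  rewrite !RintegralZl//; first by congr (_ + _); rewrite mulrC.
    by apply: bounded_mfun_integrable; exact: bounded_mfun_sin0.
  by apply: bounded_mfun_integrable; exact: bounded_mfun_cos0.
have bind x : bounded_mfun (\1_(sin_arc r x) : circle R -> R).
  split; first by apply: measurable_indic; exact: measurable_sin_arc.
  by exists 1 => y; rewrite indicE; case: (_ \in _); rewrite ?normr1 ?normr0.
(* The trivial bound [D] is used on the arc, the cancellation bound [1 / r] off it. *)
have Kle x y : K x y <= D%:R * \1_(sin_arc r x) y + r^-1.
  rewrite indicE; have [_|] := boolP (y \in sin_arc r x); last first.
    rewrite notin_setE => nb.
    have h : r <= `|sin (pi * (circle_val x - circle_val y))|.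
      by rewrite -normr_sin_frac -circle_valB leNgt; apply/negP.
    rewrite mulr0 add0r (le_trans (ler_norm _))// -(ler_pM2l r0) divff ?gt_eqF//.
    by apply: le_trans (normr_dirichlet_cos _ _ _); apply: ler_wpM2r h.
  rewrite mulr1 (@le_trans _ _ (\sum_(l < D) 1))//.
    by apply: ler_sum => l _; exact: cos_le1.
  by rewrite sumr_const card_ord lerDl invr_ge0 ltW.
have intle x : \int[nu]_y K x y <= D%:R * c + r^-1.
  apply: (@le_trans _ _ (\int[nu]_y (D%:R * \1_(sin_arc r x) y + r^-1))).
    apply: Rintegral_le; last exact: Kle.
      exact: bK.
    by apply: bounded_mfunD; [apply: bounded_mfunM => //|]; exact: bounded_mfun_cst.
  rewrite RintegralD//; last 2 first.
  - by apply: bounded_mfun_integrable; apply: bounded_mfunM => //; exact: bounded_mfun_cst.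
  - by apply: bounded_mfun_integrable; exact: bounded_mfun_cst.
  rewrite Rintegral_prob_cst lerD2r RintegralZl//; last exact: bounded_mfun_integrable.
  rewrite ler_wpM2l// /Rintegral integral_indic//; last exact: measurable_sin_arc.
  rewrite setIT -lee_fin fineK ?nuc//.
  by rewrite fin_num_measure//; exact: measurable_sin_arc.
rewrite (_ : \sum_(l < D) _ = \int[nu]_x (\sum_(l < D)
    (fourier_cos nu l * cos (2 * pi * l%:R * circle_val x) +
     fourier_sin nu l * sin (2 * pi * l%:R * circle_val x)))); last first.
  have b3 (l : 'I_D) :
      bounded_mfun (fun x => fourier_cos nu l * cos (2 * pi * l%:R * circle_val x)).
    by apply: bounded_mfunM; [exact: bounded_mfun_cst|exact: bounded_mfun_cos0].
  have b4 (l : 'I_D) :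
      bounded_mfun (fun x => fourier_sin nu l * sin (2 * pi * l%:R * circle_val x)).
    by apply: bounded_mfunM; [exact: bounded_mfun_cst|exact: bounded_mfun_sin0].
  rewrite Rintegral_sum; last by move=> l; exact: bounded_mfunD.
  apply: eq_bigr => l _; rewrite RintegralD//; [|exact: bounded_mfun_integrable..].
  rewrite !RintegralZl//.
    by apply: bounded_mfun_integrable; exact: bounded_mfun_sin0.
  by apply: bounded_mfun_integrable; exact: bounded_mfun_cos0.
rewrite -[leRHS](Rintegral_prob_cst _ nu); apply: Rintegral_le; last first.
- by move=> x; rewrite -intK.
- exact: bounded_mfun_cst.
apply: bounded_mfun_sum => l; apply: bounded_mfunD; apply: bounded_mfunM.
- exact: bounded_mfun_cst.
- exact: bounded_mfun_cos0.
- exact: bounded_mfun_cst.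
- exact: bounded_mfun_sin0.
Qed.

(** * Decay on arcs and its two-sided form *)

(** The arc of length [r] that ends at [x]. It is one-sided because the test function [t^(-a)] is
    singular only to the right of 0. *)
Definition circle_arc {R : realType} (r : R) (x : circle R) : set (circle R) :=
  [set y | circle_val (x - y) < r].

(* Hoelder continuity of nu, parametrized by integers: the arcs have length j^-K,
   and the exponent 4 is what the choice r = j^-K / 2 and N = j^(K + 4) requires
   for the energies to be O(j^-2). *)
Definition arc_decay {R : realType} (nu : probability (circle R) R) (K : nat) (C : R) :=
  forall (j : nat) (x : circle R), (0 < j)%N ->
  (nu (circle_arc (j%:R ^+ K)^-1%R x) <= (C / j%:R ^+ 4)%R%:E)%E.

Lemma frac_part_id (R : realType) (t : R) : 0 <= t < 1 -> frac_part t = t.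
Proof.
move=> t01; rewrite /frac_part.
have -> : Num.floor t = 0 by apply: floor_def; rewrite add0r.
by rewrite subr0.
Qed.

Lemma circle_valD_to_circle (R : realType) (x : circle R) (r : R) :
  circle_val (x + to_circle r) = frac_part (circle_val x + r).
Proof.
suff -> : x + to_circle r = to_circle (circle_val x + r) by [].
rewrite -[LHS]/(circle_add x (to_circle r)) /circle_add addrC.
by rewrite to_circleDl addrC.
Qed.

Lemma measurable_arc (R : realType) (r : R) (x : circle R) :
  measurable (circle_arc r x).
Proof.
rewrite (_ : circle_arc r x = setT `&` (fun y => circle_val (x - y) : R) @^-1` `]-oo, r[).
  exact: measurable_circle_sub.
by rewrite setTI; apply/seteqP; split => y /=; rewrite in_itv.
Qed.

(** The two-sided neighbourhood of radius [r = j^-K / 2] is covered by the arcs of length [2r]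
    ending at [x] and at [x + r], whence the factor 2. *)
Lemma arc_decay_sin_arc (R : realType) (nu : probability (circle R) R) K (C : R) j x :
  arc_decay nu K C -> (0 < j)%N ->
  (nu (sin_arc (2 * j%:R ^+ K)^-1%R x) <= (2 * C / j%:R ^+ 4)%R%:E)%E.
Proof.
move=> dec j0.
have jK : 1 <= j%:R ^+ K :> R by rewrite exprn_ege1// ler1n.
set r := (2 * j%:R ^+ K)^-1.
have r0 : 0 < r by rewrite invr_gt0 mulr_gt0// (lt_le_trans ltr01).
have r2 : r * 2 = (j%:R ^+ K)^-1 by rewrite /r; field; rewrite gt_eqF// (lt_le_trans ltr01).
have r21 : r * 2 <= 1 by rewrite r2 invf_le1// (lt_le_trans ltr01).
pose x' := x + to_circle r.
pose A := @circle_arc R (r * 2).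
have sub : sin_arc r x `<=` A x `|` A x'.
  move=> y; rewrite /sin_arc/= => ys.
  have /andP[t0 t1] := circle_valP (x - y).
  have [tr|tr] := ltP (circle_val (x - y)) (r * 2); [by left|right].
  suff : circle_val (x' - y) < r * 2 by [].
  rewrite /x' addrAC circle_valD_to_circle.
  have [tr1|tr1] := leP (circle_val (x - y)) (1 - r).
    suff : r <= `|sin (pi * circle_val (x - y))| by rewrite leNgt ys.
    by apply: normr_sin_pi_ge; rewrite ger0_norm//; lra.
  (* Here [y] lies just ahead of [x]: adding [r] wraps past 1, and the value becomes
     [t + r - 1 < r], where [t] is the value of [x - y]. *)
  rewrite -(@frac_partDz R _ (-1)) mulrN1z frac_part_id; first lra.
  by apply/andP; split; lra.
have mA z : measurable (A z) by exact: measurable_arc.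
apply: (@le_trans _ _ (nu (A x `|` A x'))).
  by apply: le_measure => //; rewrite inE; [exact: measurable_sin_arc|exact: measurableU].
apply: (le_trans (measureU2 _ _ _)) => //.
rewrite (_ : 2 * C / _ = C / j%:R ^+ 4 + C / j%:R ^+ 4); last by ring.
by rewrite EFinD leeD// /A r2 dec.
Qed.

(** * Second moments of Weyl sums *)

Lemma sum_inj_le (R : realType) N D (P : pred 'I_N) (h : 'I_N -> nat) (g : nat -> R) :
  (forall l, 0 <= g l) -> (forall k, P k -> (h k < D)%N) ->
  {in P &, injective h} -> \sum_(k < N | P k) g (h k) <= \sum_(l < D) g l.
Proof.
move=> g0 hD hinj; case: D hD => [|D] hD.
  by rewrite big_ord0 big_pred0// => k; apply/negP => /hD.
pose h' (k : 'I_N) : 'I_D.+1 := inord (h k).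
have h'E k : P k -> h' k = h k :> nat by move=> Pk; rewrite inordK// hD.
rewrite (eq_bigr (fun k => g (h' k))); last by move=> k Pk; rewrite h'E.
have h'inj : {in [set k | P k]%SET &, injective h'}.
  move=> k l; rewrite !inE => Pk Pl /(congr1 val) /=; rewrite !h'E//.
  exact: hinj.
rewrite [leRHS](bigID (mem (h' @: [set k | P k]%SET))) /=.
rewrite (big_imset _ h'inj)/= [X in X <= _ + _](_ : _ = \sum_(k in [set k | P k]%SET) g (h' k)).
  by rewrite lerDl sumr_ge0.
by apply: eq_bigl => k; rewrite inE.
Qed.

Lemma fourier_cos_sub (R : realType) (nu : probability (circle R) R) (a b : nat) :
  \int[nu]_x cos (2 * pi * a%:R * circle_val x - 2 * pi * b%:R * circle_val x)
  = fourier_cos nu `|a - b|%N.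
Proof.
rewrite /fourier_cos; apply: eq_Rintegral => x _.
have [ab|/ltnW ab] := leqP b a.
  by rewrite distnEl// natrB//; congr cos; ring.
by rewrite distnEr// natrB// -cosN; congr cos; ring.
Qed.

(** [|T_N(x) / N|^2] for the exponential sum [T_N]. *)
Definition weyl_energy {R : realType} (n : nat -> nat) (N : nat) (x : circle R) : R :=
  avg (fun k => cos (2 * pi * (n k)%:R * circle_val x)) N ^+ 2 +
  avg (fun k => sin (2 * pi * (n k)%:R * circle_val x)) N ^+ 2.

Lemma bounded_mfun_weyl_energy (R : realType) n N : bounded_mfun (@weyl_energy R n N).
Proof.
have sq (f : nat -> circle R -> R) : (forall k, bounded_mfun (f k)) ->
    bounded_mfun (fun x => avg (fun k => f k x) N ^+ 2).
  move=> bf; have bavg : bounded_mfun (fun x => avg (fun k => f k x) N).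
    by apply: bounded_mfunM; [exact: bounded_mfun_cst|exact: bounded_mfun_sum].
  by under [X in bounded_mfun X]eq_fun do rewrite expr2; exact: bounded_mfunM.
by apply: bounded_mfunD; apply: sq => k; [exact: bounded_mfun_cos0|exact: bounded_mfun_sin0].
Qed.

(** Expanding the square gives the coefficients at [n_j - n_k]. For fixed [j] the distances
    [|n_j - n_k|] are distinct among the [k] with [n_k <= n_j], and again among the others; hence
    the factor 2. *)
Lemma Rintegral_weyl_energy_le (R : realType) (nu : probability (circle R) R) n N D :
  (0 < N)%N -> injective n -> (forall k, (k < N)%N -> (n k < D)%N) ->
  \int[nu]_x weyl_energy n N x <= 2 / N%:R * \sum_(l < D) `|fourier_cos nu l|.
Proof.
move=> N0 ninj nD; have Np : 0 < N%:R :> R by rewrite ltr0n.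
have E (x : circle R) : weyl_energy n N x = (N%:R ^+ 2)^-1 *
    \sum_(j < N) \sum_(k < N)
      cos (2 * pi * (n j)%:R * circle_val x - 2 * pi * (n k)%:R * circle_val x).
  rewrite -(@sum_cos_sqr R N (fun k => 2 * pi * (n k)%:R * circle_val x)).
  by rewrite /weyl_energy /avg !exprMn !exprVn -mulrDr.
have bjk (j k : 'I_N) : bounded_mfun (fun x : circle R =>
    cos (2 * pi * (n j)%:R * circle_val x - 2 * pi * (n k)%:R * circle_val x)).
  have := @bounded_mfun_cos0 R (2 * pi * ((n j)%:R - (n k)%:R)).
  by congr bounded_mfun; apply/funext => x; congr cos; ring.
under eq_Rintegral do rewrite E.
rewrite RintegralZl//; last first.
  by apply: bounded_mfun_integrable; do 2!apply: bounded_mfun_sum => ?; exact: bjk.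
rewrite Rintegral_sum; last by move=> j; exact: bounded_mfun_sum.
apply: (@le_trans _ _ ((N%:R ^+ 2)^-1 *
    \sum_(j < N) (2 * \sum_(l < D) `|fourier_cos nu l|))); last first.
  rewrite sumr_const card_ord -(mulr_natl _ N) le_eqVlt; apply/orP; left; apply/eqP.
  by field; rewrite gt_eqF.
rewrite ler_wpM2l// ?invr_ge0 ?sqr_ge0//; apply: ler_sum => j _.
rewrite Rintegral_sum//; under eq_bigr do rewrite fourier_cos_sub.
apply: (@le_trans _ _ (\sum_(k < N) `|fourier_cos nu `|n j - n k|%N|)).
  by apply: ler_sum => k _; exact: ler_norm.
rewrite (bigID (fun k : 'I_N => (n k <= n j)%N))/= mulr_natl mulr2n; apply: lerD.
- apply: (@sum_inj_le R N D _ (fun k => `|n j - n k|%N)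
    (fun l => `|fourier_cos nu l|)) => // [k kj|k l].
    by rewrite distnEl// (leq_ltn_trans (leq_subr _ _))// nD.
  rewrite !unfold_in => kj lj; rewrite !distnEl// => e; apply/val_inj/ninj => /=.
  by rewrite -(subKn kj) e subKn.
- apply: (@sum_inj_le R N D _ (fun k => `|n j - n k|%N)
    (fun l => `|fourier_cos nu l|)) => // [k|k l].
    rewrite -ltnNge => /ltnW kj; rewrite distnEr//.
    by rewrite (leq_ltn_trans (leq_subr _ _))// nD.
  rewrite !unfold_in -!ltnNge => /ltnW kj /ltnW lj; rewrite !distnEr// => e.
  by apply/val_inj/ninj => /=; rewrite -(subnK kj) e subnK.
Qed.

(** AM-GM with weight [j^2], then the energy bound with [r = j^-K / 2] and [c = 2C / j^4]. *)
Lemma sum_abs_fourier_cos_le (R : realType) (nu : probability (circle R) R) K (C : R) j D :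
  arc_decay nu K C -> (0 < j)%N ->
  \sum_(l < D) `|fourier_cos nu l| <=
    (D%:R / j%:R ^+ 2) * (1 + 2 * C) + 2 * j%:R ^+ (K + 2).
Proof.
move=> dec j0; have jp : 0 < j%:R :> R by rewrite ltr0n.
have j2 : 0 < j%:R ^+ 2 :> R by rewrite exprn_gt0.
have jK : 0 < j%:R ^+ K :> R by rewrite exprn_gt0.
have r0 : 0 < (2 * j%:R ^+ K)^-1 :> R by rewrite invr_gt0 mulr_gt0.
have := @energy_le R nu _ _ D r0 (fun x => @arc_decay_sin_arc R nu K C j x dec j0).
rewrite invrK => en.
apply: (@le_trans _ _ (\sum_(l < D) ((j%:R ^+ 2)^-1 +
    j%:R ^+ 2 * (fourier_cos nu l ^+ 2 + fourier_sin nu l ^+ 2)))).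
  apply: ler_sum => l _.
  apply: (@le_trans _ _ ((j%:R ^+ 2)^-1 + j%:R ^+ 2 * (fourier_cos nu l ^+ 2))); last first.
    by rewrite lerD2l; apply: ler_wpM2l; [exact: ltW|rewrite lerDl sqr_ge0].
  (* AM-GM: [|c| <= j^-2 + j^2 c^2] *)
  rewrite -(ler_pM2l j2) mulrDr divff ?gt_eqF//.
  rewrite -[fourier_cos nu l ^+ 2]real_normK ?num_real//.
  have : 0 <= (1 - j%:R ^+ 2 * `|fourier_cos nu l|) ^+ 2 by exact: sqr_ge0.
  have : 0 <= j%:R ^+ 2 * `|fourier_cos nu l| by rewrite mulr_ge0// ltW.
  nra.
rewrite big_split/= -mulr_sumr sumr_const card_ord -[X in X + _ <= _](mulr_natl _ D).
have := en; rewrite -(ler_pM2l j2); move/(lerD (lexx (D%:R * (j%:R ^+ 2)^-1))).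
move/le_trans; apply; rewrite le_eqVlt; apply/orP; left; apply/eqP.
by rewrite exprD; field; rewrite gt_eqF.
Qed.

(** * Almost everywhere convergence of Weyl sums *)

Lemma bounded_gaps_lt (n : nat -> nat) (C N k : nat) :
  (forall k, `|(n k.+1)%:Z - (n k)%:Z| <= C%:Z) -> (k < N)%N ->
  (n k < (n 0 + C + 1) * N)%N.
Proof.
move=> gap kN; have nk : (n k <= n 0 + C * k)%N.
  elim: k {kN} => [|k IH]; first by rewrite muln0 addn0.
  by have := gap k; rewrite mulnS; lia.
by nia.
Qed.

Lemma weyl_energy_decay (R : realType) (nu : probability (circle R) R) K (C : R)
    (n : nat -> nat) :
  arc_decay nu K C -> injective n ->
  (exists C : nat, forall k, `|(n k.+1)%:Z - (n k)%:Z| <= C%:Z) ->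
  exists B : R, forall j, (0 < j)%N ->
    \int[nu]_x weyl_energy n (j ^ (K + 4)) x <= B / j%:R ^+ 2.
Proof.
(* With [N = j^(K+4)] and [D = (n 0 + g + 1) N], the first summand comes from [D / N], and 4 from
   [(2 / N) * 2 j^(K+2) = 4 / j^2]. *)
move=> dec ninj [g gap]; exists (2 * (n 0 + g + 1)%:R * (1 + 2 * C) + 4) => j j0.
have N0 : (0 < j ^ (K + 4))%N by rewrite expn_gt0 j0.
have jp : 0 < j%:R :> R by rewrite ltr0n.
apply: (le_trans (@Rintegral_weyl_energy_le R nu n _ _ N0 ninj
  (fun k => @bounded_gaps_lt n g _ k gap))).
have := @sum_abs_fourier_cos_le R nu K C j ((n 0 + g + 1) * j ^ (K + 4)) dec j0.
have c0 : 0 <= 2 / (j ^ (K + 4))%:R :> R by rewrite divr_ge0.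
move/(ler_wpM2l c0)/le_trans; apply; rewrite le_eqVlt; apply/orP; left; apply/eqP.
rewrite natrM natrX (_ : (K + 4)%N = (K + 2 + 2)%N); last by rewrite -addnA.
rewrite !(exprD _ _ 2).
have j2 : 0 < j%:R ^+ 2 :> R by rewrite exprn_gt0.
have jK : 0 < j%:R ^+ K :> R by rewrite exprn_gt0.
by field; rewrite !gt_eqF.
Qed.

(** Telescoping: [1 / t^2 <= 2 (1/t - 1/(t+1))] for [t >= 1]. *)
Lemma sum_invr_sqr_le (R : realType) N :
  \sum_(j < N) (j.+1%:R ^+ 2)^-1 <= 2 * (1 - N.+1%:R^-1) :> R.
Proof.
elim: N => [|N IH]; first by rewrite big_ord0 invr1 subrr mulr0.
rewrite big_ord_recr/= (le_trans (lerD IH (lexx _)))//.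
have N1 : 0 < N.+1%:R :> R by rewrite ltr0n.
have -> : N.+2%:R = N.+1%:R + 1 :> R by rewrite natr1.
move: (N.+1%:R) N1 (ler1n R N.+1) => t t0; rewrite /= => t1.
rewrite -subr_ge0.
have -> : 2 * (1 - (t + 1)^-1) - (2 * (1 - t^-1) + (t ^+ 2)^-1) =
  (t - 1) / (t ^+ 2 * (t + 1)) by field; rewrite !gt_eqF//; lra.
by rewrite divr_ge0// ?subr_ge0// mulr_ge0 ?sqr_ge0//; lra.
Qed.

(** By monotone convergence the series of the [f j] has a finite integral, so it is finite almost
    everywhere and its terms tend to 0. *)
Lemma ae_cvg0_summable (R : realType) (nu : probability (circle R) R)
    (f : nat -> circle R -> R) (B : R) :
  (forall j, bounded_mfun (f j)) -> (forall j x, 0 <= f j x) ->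
  (forall j, \int[nu]_x f j x <= B / j.+1%:R ^+ 2) ->
  {ae nu, forall x, f j x @[j --> \oo] --> 0}.
Proof.
move=> bf f0 fB.
have mf j : measurable_fun [set: circle R] (fun x => (f j x)%:E).
  by apply/measurable_EFinP; exact: (bf j).1.
have f0' j x : (0 <= (f j x)%:E)%E by rewrite lee_fin.
pose F x := (\sum_(0 <= j <oo) (f j x)%:E)%E.
have F0 x : (0 <= F x)%E by apply: nneseries_ge0 => j _ _.
have mF : measurable_fun [set: circle R] F.
  by apply: ge0_emeasurable_sum => j *.
have intF : nu.-integrable setT F.
  apply/integrableP; split => //.
  under eq_integral do rewrite gee0_abs//.
  rewrite /F integral_nneseries//.
  apply: (@le_lt_trans _ _ (B * 2)%:E); last exact: ltry.
  apply: lime_le.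
    by apply: is_cvg_nneseries => j _ _; exact: integral_ge0.
  near=> N; rewrite big_mkord.
  rewrite (eq_bigr (fun j : 'I_N => (\int[nu]_x f j x)%:E)); last first.
    move=> j _; rewrite /Rintegral fineK//; apply: integrable_fin_num => //.
    exact: bounded_mfun_integrable.
  rewrite sumEFin lee_fin.
  apply: (@le_trans _ _ (\sum_(j < N) B / j.+1%:R ^+ 2)).
    exact: ler_sum.
  rewrite -mulr_sumr ler_wpM2l//.
    (* [B] is non-negative, as it bounds the integral of [f 0]. *)
    have := fB 0%N; rewrite expr1n divr1; apply: le_trans.
    exact: Rintegral_ge0.
  apply: (le_trans (@sum_invr_sqr_le R N)).
  by rewrite -[leRHS]mulr1 ler_wpM2l// gerBl invr_ge0.
have := integrable_ae measurableT intF.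
apply: filterS => x /(_ I) Fx.
have Foo : (F x < +oo)%E by rewrite ltey_eq Fx.
have tail := nneseries_tail_cvg Foo (fun j _ => f0' j x).
(* Each term is at most the tail of the series that starts with it. *)
have : (f j x)%:E @[j --> \oo] --> 0%E.
  apply: (@squeeze_cvge _ _ _ _ (cst 0%E) _ _ _ _ _ tail); last exact: cvg_cst.
  near=> N; rewrite f0' /=.
  rewrite (nneseries_split _ 1)//.
  rewrite addn1 big_nat1 leeDl//.
  by apply: nneseries_ge0.
by move/fine_cvgP => [_].
Unshelve. all: by end_near. Qed.

(** Bernoulli's inequality. *)
Lemma one_sub_expr_le (R : realType) (x : R) s : 0 <= x <= 1 ->
  1 - x ^+ s <= s%:R * (1 - x).
Proof.
move=> /andP[x0 x1]; elim: s => [|s IH]; first by rewrite expr0 subrr mul0r.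
rewrite -natr1 exprS.
have : x ^+ s <= 1 by rewrite exprn_ile1.
have : 0 <= x ^+ s by rewrite exprn_ge0.
move: IH; move: (x ^+ s) (s%:R : R) => y t *; nra.
Qed.

(** The terms from [M] to [N] add at most [N - M] to the sum. *)
Lemma avg_abs_le (R : realType) (w : nat -> R) (M N : nat) :
  (forall k, `|w k| <= 1) -> (0 < M <= N)%N ->
  `|avg w N| <= `|avg w M| + (1 - M%:R / N%:R).
Proof.
move=> w1 /andP[M0 MN].
have Mp : 0 < M%:R :> R by rewrite ltr0n.
have Np : 0 < N%:R :> R by rewrite ltr0n (leq_trans M0).
have MNr : M%:R <= N%:R :> R by rewrite ler_nat.
rewrite -(ler_pM2l Np) /avg !normrM !normfV !(gtr0_norm Mp) !(gtr0_norm Np).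
rewrite mulVKf ?gt_eqF// mulrDr mulrBr mulr1 [N%:R * (M%:R / _)]mulrC divfK ?gt_eqF//.
rewrite -(big_mkord xpredT) (big_cat_nat (n := M))//= big_mkord.
apply: (le_trans (ler_normD _ _)); apply: lerD.
  rewrite mulrA ler_peMl// ler_pdivlMr// mul1r//.
apply: (le_trans (ler_norm_sum _ _ _)).
apply: (@le_trans _ _ (\sum_(M <= i < N) 1)); first exact: ler_sum.
by rewrite sumr_const_nat natrB.
Qed.

(** For [j^s <= N < (j+1)^s], passing from [j^s] to [N] costs at most
    [1 - (j/(j+1))^s <= s/(j+1)]. *)
Lemma cvg_avg_subseq (R : realType) (w : nat -> R) (s : nat) :
  (0 < s)%N -> (forall k, `|w k| <= 1) ->
  avg w (j.+1 ^ s) @[j --> \oo] --> 0 -> avg w @ \oo --> 0.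
Proof.
move=> s0 w1 /cvgrPdist_lt wj; apply/cvgrPdist_lt => e e0.
have e2 : 0 < e / 2 by lra.
have [J _ HJ] := wj _ e2.
(* The first threshold is shifted by one because the hypothesis is indexed by [j.+1]; the second
   makes [s/(j+1) < e/2]. *)
pose L := maxn J.+1 (Num.trunc (2 * s%:R / e)).+1.
exists (L ^ s)%N => // N /= LN.
have N0 : (0 < N)%N by apply: leq_trans LN; rewrite expn_gt0 /L leq_max.
have ub : exists j, (j ^ s <= N)%N by exists 0%N; rewrite exp0n.
have bd j : (j ^ s <= N)%N -> (j <= N)%N.
  by apply: leq_trans; rewrite -[leqLHS]expn1; case: j => [//|j]; rewrite leq_pexp2l.
have [j jN jmax] := ex_maxnP ub bd.
have Lj : (L <= j)%N by exact: jmax.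
have j0 : (0 < j)%N by apply: leq_trans Lj; rewrite /L leq_max.
have Nj : (N < j.+1 ^ s)%N by rewrite ltnNge; apply/negP => /jmax; rewrite ltnn.
have jr : 0 < j%:R :> R by rewrite ltr0n.
have Nr : 0 < N%:R :> R by rewrite ltr0n.
rewrite sub0r normrN.
have js0 : (0 < j ^ s <= N)%N by rewrite expn_gt0 j0.
apply: (le_lt_trans (@avg_abs_le R w _ _ w1 js0)).
have h1 : `|avg w (j ^ s)| < e / 2.
  have := HJ j.-1 _; rewrite sub0r normrN prednK//; apply.
  rewrite /= -ltnS prednK//; apply: leq_trans Lj; exact: leq_maxl.
have h2 : 1 - (j ^ s)%:R / N%:R <= 1 - (j%:R / j.+1%:R) ^+ s :> R.
  rewrite lerB// expr_div_n -!natrX ler_pM2l ?ltr0n ?expn_gt0 ?j0//.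
  by rewrite lef_pV2 ?posrE ?ltr0n ?expn_gt0// ler_nat ltnW.
have h3 : 1 - (j%:R / j.+1%:R) ^+ s <= s%:R * (1 - j%:R / j.+1%:R) :> R.
  apply: one_sub_expr_le; rewrite divr_ge0//= ler_pdivrMr ?ltr0n// mul1r.
  by rewrite ler_nat.
have h4 : s%:R * (1 - j%:R / j.+1%:R) < e / 2.
  have jl : 2 * s%:R / e < j.+1%:R.
    apply: (lt_le_trans (truncnS_gt _)); rewrite ler_nat.
    by rewrite (leq_trans (leq_trans (leq_maxr _ _) Lj)).
  have j1 : 0 < j.+1%:R :> R by rewrite ltr0n.
  move: jl; rewrite -natr1 in j1 *; rewrite ltr_pdivrMr// => jl.
  rewrite (_ : 1 - _ = (j%:R + 1)^-1); last by field; rewrite gt_eqF.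
  by rewrite ltr_pdivrMr//; lra.
by rewrite [ltRHS]splitr ltrD// (le_lt_trans h2)// (le_lt_trans h3).
Qed.

Lemma ae_avg_trig (R : realType) (nu : probability (circle R) R) K (C : R)
    (n : nat -> nat) :
  arc_decay nu K C -> injective n ->
  (exists C : nat, forall k, `|(n k.+1)%:Z - (n k)%:Z| <= C%:Z) ->
  {ae nu, forall x : circle R,
    avg (fun k => cos (2 * pi * (n k)%:R * circle_val x)) @ \oo --> 0 /\
    avg (fun k => sin (2 * pi * (n k)%:R * circle_val x)) @ \oo --> 0}.
Proof.
move=> dec ninj gap; have [B hB] := @weyl_energy_decay R nu K C n dec ninj gap.
have := @ae_cvg0_summable R nu (fun j => weyl_energy n (j.+1 ^ (K + 4))) B
  (fun j => @bounded_mfun_weyl_energy R n _) _ (fun j => hB j.+1 (ltn0Sn j)).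
move=> /(_ (fun j x => addr_ge0 (sqr_ge0 _) (sqr_ge0 _))).
apply: filterS => x /cvgrPdist_lt hx.
have sub (u : nat -> R) : (forall k, `|u k| <= 1) ->
    (forall N, avg u N ^+ 2 <= weyl_energy n N x) -> avg u @ \oo --> 0.
  move=> u1 ule; apply: (@cvg_avg_subseq R u (K + 4)) => //; first by rewrite addnS.
  apply/cvgrPdist_lt => e e0; have := hx (e ^+ 2) (exprn_gt0 _ e0).
  apply: filterS => j; rewrite !sub0r !normrN => he.
  rewrite -ltr_sqr ?nnegrE// ?ltW// real_normK ?num_real//.
  by apply: le_lt_trans he; rewrite (le_trans (ule _))// ler_norm.
split; apply: sub => [k|N].
- exact: cos_max.
- by rewrite /weyl_energy lerDl sqr_ge0.
- exact: sin_max.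
- by rewrite /weyl_energy lerDr sqr_ge0.
Qed.

(** Frequency [m] of [n_k x] is frequency 1 of [m n_k x], and [m n_k] is again injective with
    bounded gaps; countably many null sets are discarded. *)
Lemma ae_unif_dist (R : realType) (nu : probability (circle R) R) K (C : R)
    (n : nat -> nat) :
  arc_decay nu K C -> injective n ->
  (exists C : nat, forall k, `|(n k.+1)%:Z - (n k)%:Z| <= C%:Z) ->
  {ae nu, forall x : circle R, unif_dist_mod1 (fun k => (n k)%:R * circle_val x)}.
Proof.
move=> dec ninj [g gap].
have : {ae nu, forall x, forall m : nat, (0 < m)%N ->
    avg (fun k => cos (2 * pi * (m * n k)%:R * circle_val x)) @ \oo --> (0 : R) /\
    avg (fun k => sin (2 * pi * (m * n k)%:R * circle_val x)) @ \oo --> (0 : R)}.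
  apply: ae_foralln => -[|m]; first by apply: aeW.
  have hinj : injective (fun k => m.+1 * n k)%N.
    by move=> k l /eqP; rewrite eqn_pmul2l// => /eqP /ninj.
  have hgap : exists C : nat,
      forall k, `|(m.+1 * n k.+1)%:Z - (m.+1 * n k)%:Z| <= C%:Z.
    exists (m.+1 * g)%N => k; have := gap k.
    by rewrite !PoszM -mulrBr normrM (ger0_norm (_ : 0 <= m.+1%:Z))// => ?; rewrite ler_pM2l.
  have := @ae_avg_trig R nu K C (fun k => m.+1 * n k)%N dec hinj hgap.
  by apply: filterS => x hx _.
apply: filterS => x hx; apply: weyl_criterion => m m0; have [hc hs] := hx m m0.
have e k : 2 * pi * (m * n k)%:R * circle_val x =
    2 * pi * m%:R * ((n k)%:R * circle_val x) by rewrite natrM; ring.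
by split; [move: hc|move: hs]; under [X in avg X]eq_fun do rewrite e.
Qed.

(** * Translation invariance of the circle measure *)

(** By uniqueness of Lebesgue measure, checked on half-open intervals. *)
Lemma lebesgue_measure_shift (R : realType) (c : R) (A : set R) : measurable A ->
  lebesgue_measure ((fun t : R => t + c) @^-1` A) = lebesgue_measure A.
Proof.
move=> mA.
have mf : measurable_fun [set: measurableTypeR R] ((fun t => t + c) : _ -> measurableTypeR R).
  exact: measurable_funD.
pose m := measure_function_pushforward__canonical__measure_function_Measure
  (@lebesgue_measure R) mf.
have := @lebesgue_measure_unique R m _ A mA.
rewrite /m/= /pushforward => <- // X [[a b] _ <-]/=.
rewrite (_ : _ @^-1` _ = `]a - c, b - c]%classic); last first.
  by apply/seteqP; split => t /=; rewrite !in_itv/= ltrBlDr lerBrDr.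
rewrite !lebesgue_measure_itv/= !lte_fin ltrD2r.
by case: ifP => // _; congr (_%:E); ring.
Qed.

Lemma circle_measureE (R : realType) (A : set (circle R)) :
  circle_measure A = lebesgue_measure (@to_circle R @^-1` A `&` `[0, 1[).
Proof. by []. Qed.

Lemma to_circleB (R : realType) (t : R) (x : circle R) :
  to_circle t - x = to_circle (t - circle_val x).
Proof.
rewrite -[LHS]/(circle_add (to_circle t) (circle_opp x)) /circle_add to_circleDl.
by rewrite addrC /circle_opp to_circleDl addrC.
Qed.

(** On the line the translation replaces [[0, 1)] by [[-c, 1 - c)], another fundamental domain for
    the 1-periodic set [A']; the two differ by one piece moved by a period. *)
Lemma circle_measure_shift (R : realType) (x : circle R) (A : set (circle R)) :
  measurable A -> circle_measure ((fun t => t - x) @^-1` A) = circle_measure A.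
Proof.
move=> mA; rewrite !circle_measureE.
pose A' : set R := @to_circle R @^-1` A.
have mA' : measurable A'.
  rewrite /A' -[X in measurable X]setTI; exact: measurable_to_circle.
pose c := circle_val x; have /andP[c0 c1] : 0 <= c < 1 := circle_valP x.
have perA (t : R) : A' (t + 1) = A' t.
  by rewrite /A'/= -(to_circleDz t 1).
have E1 : @to_circle R @^-1` ((fun t => t - x) @^-1` A) `&` `[0, 1[ =
    (fun t : R => t - c) @^-1` (A' `&` `[- c, 1 - c[).
  apply/seteqP; split => t /=; rewrite !in_itv/= to_circleB -/c => -[? h];
    split => //; move: h; lra.
have mI (i : interval R) : measurable (A' `&` [set` i]) by exact: measurableI.
rewrite E1 lebesgue_measure_shift; last exact: mI.
rewrite -/A'.
have s1 : A' `&` `[- c, 1 - c[ = (A' `&` `[- c, 0[) `|` (A' `&` `[0, 1 - c[).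
  rewrite -setIUr; congr (_ `&` _).
  by rewrite -itv_bndbnd_setU//= bnd_simp; lra.
have s2 : A' `&` `[0, 1[ = (A' `&` `[1 - c, 1[) `|` (A' `&` `[0, 1 - c[).
  rewrite -setIUr setUC; congr (_ `&` _).
  by rewrite -itv_bndbnd_setU//= bnd_simp; lra.
have itv0 (u v w z : R) : v <= w -> `[u, v[%classic `&` `[w, z[%classic = set0.
  by move=> vw; apply/seteqP; split => t //=; rewrite !in_itv/= => -[]; lra.
have dis (i j : interval R) : [set` i] `&` [set` j] = set0 ->
    (A' `&` [set` i]) `&` (A' `&` [set` j]) = set0.
  by move=> ij; rewrite setIACA setIid ij setI0.
rewrite s1 s2 !measureU; [|exact: mI|exact: mI|by apply: dis; rewrite setIC itv0
  |exact: mI|exact: mI|by apply: dis; rewrite itv0].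
congr (_ + _)%E.
(* Pulled back by one period, the piece on [[1 - c, 1)] becomes the one on [[-c, 0)]. *)
apply: (etrans _ (@lebesgue_measure_shift R 1 (A' `&` `[1 - c, 1[) (mI _))).
congr lebesgue_measure; apply/seteqP; split => t /=; rewrite perA !in_itv/= => -[? h];
  split => //; move: h; lra.
Qed.

(** * Negative powers on the circle *)

Lemma circle_measure_arc0 (R : realType) (r : R) : 0 <= r <= 1 ->
  circle_measure [set t : circle R | circle_val t < r] = r%:E.
Proof.
move=> /andP[r0 r1]; rewrite circle_measureE.
rewrite (_ : _ `&` _ = `[0, r[%classic).
  rewrite lebesgue_measure_itv/= lte_fin oppr0 adde0.
  by case: ltP => // r0'; congr EFin; lra.
apply/seteqP; split => t /=; rewrite !in_itv/= => h.
  move: h => [+ t01]; rewrite frac_part_id; lra.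
by rewrite frac_part_id; lra.
Qed.

(** The point 0 is excluded because [powR] takes the value 0 there for a nonzero exponent, where
    [t^(-a)] should be large. *)
Lemma circle_measure_oarc0 (R : realType) (r : R) : 0 <= r <= 1 ->
  circle_measure [set t : circle R | 0 < circle_val t < r] = r%:E.
Proof.
move=> /andP[r0 r1]; rewrite circle_measureE.
rewrite (_ : _ `&` _ = `]0, r[%classic).
  rewrite lebesgue_measure_itv/= lte_fin oppr0 adde0.
  by case: ltP => // r0'; congr EFin; lra.
apply/seteqP; split => t /=; rewrite !in_itv/= => h.
  move: h => [+ t01]; rewrite frac_part_id; lra.
by rewrite frac_part_id; lra.
Qed.

Lemma measurable_arc0 (R : realType) (r : R) :
  measurable [set t : circle R | circle_val t < r].
Proof.
rewrite (_ : [set _ | _] = setT `&` (@circle_val R) @^-1` `]-oo, r[).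
  exact: measurable_circle_val.
by rewrite setTI; apply/seteqP; split => y /=; rewrite in_itv.
Qed.

Lemma measurable_oarc0 (R : realType) (r : R) :
  measurable [set t : circle R | 0 < circle_val t < r].
Proof.
rewrite (_ : [set _ | _] = setT `&` (@circle_val R) @^-1` `]0, r[).
  exact: measurable_circle_val.
by rewrite setTI; apply/seteqP; split => y /=; rewrite in_itv.
Qed.

Lemma dyadic_scale (R : realType) (t : R) : 0 < t < 1 ->
  exists j : nat, 2^-1 ^+ j.+1 <= t < 2^-1 ^+ j.
Proof.
move=> /andP[t0 t1].
have ex : exists j : nat, 2^-1 ^+ j.+1 <= t.
  (* With [j] the integer part of [1/t], [2^(j+1) > j + 1 > 1/t]. *)
  exists (Num.trunc t^-1).
  have := truncnS_gt t^-1; move: (Num.trunc _) => j tj.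
  rewrite exprVn invf_ple ?posrE ?exprn_gt0//.
  apply/ltW/(lt_trans tj); rewrite -natrX ltr_nat; exact: ltn_expl.
have [j jt jmin] := ex_minnP ex; exists j; rewrite jt /=.
case: j jt jmin => [|j] jt jmin; first by rewrite expr0.
by rewrite ltNge; apply/negP => /jmin; rewrite ltnn.
Qed.

Lemma measurable_circle_powR (R : realType) (b : R) :
  measurable_fun [set: circle R] (fun t => circle_val t `^ b : R).
Proof.
apply: (@measurableT_comp _ _ _ _ _ _ (fun z : R => z `^ b)).
  exact: measurable_powR.
exact: measurable_circle_val.
Qed.

(** On [2^-(j+1) <= t < 2^-j] one has [t^(-b) <= c^(j+1)] with [c = 2^b]. The dyadic majorant
    integrates to the geometric series of [c (c/2)^j], which converges because [b < 1] gives
    [c < 2]. *)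
Lemma integral_circle_powR (R : realType) (b : R) : 0 < b < 1 ->
  (\int[@circle_measure R]_t (circle_val t `^ (- b))%:E < +oo)%E.
Proof.
move=> /andP[b0 b1].
pose A j := [set t : circle R | circle_val t < 2^-1 ^+ j].
pose c : R := 2 `^ b.
have c0 : 0 < c by exact: powR_gt0.
have c2 : c < 2.
  have : 1 `^ (1 - b) < 2 `^ (1 - b) :> R.
    by apply: gt0_ltr_powR; rewrite ?nnegrE ?subr_gt0// ltr1n.
  rewrite powR1 -(ltr_pM2l c0) mulr1 /c -powRD; last by rewrite pnatr_eq0 implybT.
  by rewrite addrC subrK powRr1.
pose h j t : R := c ^+ j.+1 * \1_(A j) t.
have mA j : measurable (A j) by exact: measurable_arc0.
have h0 j t : 0 <= h j t by rewrite mulr_ge0// exprn_ge0// ltW.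
have mh j : measurable_fun [set: circle R] (fun t => (h j t)%:E).
  by apply/measurable_EFinP; apply: measurable_funM => //; exact: measurable_indic.
apply: (@le_lt_trans _ _ (\int[@circle_measure R]_t (\sum_(0 <= j <oo) (h j t)%:E))%E).
  apply: ge0_le_integral => //.
  - by move=> t _; rewrite lee_fin powR_ge0.
  - by apply/measurable_EFinP; exact: measurable_circle_powR.
  - by apply: ge0_emeasurable_sum => // j t _ _; rewrite lee_fin.
  move=> t _; have /andP[t0 t1] := circle_valP t.
  have hs0 j : (0 <= (h j t)%:E)%E by rewrite lee_fin.
  have [e|tn0] := eqVneq (circle_val t) 0.
    by rewrite e powR0 ?oppr_eq0 ?gt_eqF//; exact: nneseries_ge0.
  have tp : 0 < circle_val t by rewrite lt0r tn0.
  have [j /andP[jt tj]] := @dyadic_scale R (circle_val t) ltac:(by rewrite tp t1).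
  apply: (@le_trans _ _ (\sum_(0 <= i < j.+1) (h i t)%:E)%E); last first.
    exact: nneseries_lim_ge.
  rewrite big_nat_recr//= (le_trans _ (leeDr _ _))//; last exact: sume_ge0.
  rewrite lee_fin /h indicE mem_set// mulr1.
  rewrite powRN invf_ple ?posrE ?powR_gt0 ?exprn_gt0//.
  rewrite (_ : (c ^+ j.+1)^-1 = (2^-1 ^+ j.+1) `^ b).
    by apply: ge0_ler_powR => //; rewrite ?nnegrE ?exprn_ge0// ?invr_ge0// ltW.
  rewrite -powR_mulrn ?powR_ge0// -powRrM -powRN exprVn -powR_invn// -powRrM.
  by rewrite mulrC mulNr.
rewrite integral_nneseries//; last by move=> j t _; rewrite lee_fin.
have z1 : `|c / 2| < 1 by rewrite ger0_norm ?divr_ge0 ?ltW// ltr_pdivrMr// mul1r.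
apply: (@le_lt_trans _ _ (c * (1 - c / 2)^-1)%:E); last exact: ltry.
apply: lime_le.
  by apply: is_cvg_nneseries => j _ _; apply: integral_ge0 => t _; rewrite lee_fin.
near=> N; rewrite big_mkord.
rewrite (eq_bigr (fun j : 'I_N => (geometric c (c / 2) j)%:E)); last first.
  move=> j _; rewrite /h; under eq_integral do rewrite EFinM.
  rewrite ge0_integralZl//; last 2 first.
  - by apply/measurable_EFinP; exact: measurable_indic.
  - by rewrite lee_fin exprn_ge0// ltW.
  have mAj : circle_measure (A j) = (2^-1 ^+ j)%:E.
    by apply: circle_measure_arc0; rewrite exprn_ge0//= exprn_ile1// invf_le1// ler1n.
  rewrite integral_indic// setIT [X in (_ * X)%E]mAj.
  by rewrite -EFinM /geometric/= exprS expr_div_n exprVn mulrA.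
rewrite sumEFin lee_fin -(big_mkord xpredT).
apply: geometric_le_lim => //; first exact: ltW.
by rewrite divr_gt0.
Unshelve. all: by end_near. Qed.

(** * Convolution of negative powers with a probability *)

Lemma hyperbounded_real (R : realType) (nu : probability (circle R) R) :
  hyperbounded nu -> exists p q : R, [/\ 1 < p, p < q &
    forall f : circle R -> R, f \in Lfun (@circle_measure R) p%:E ->
      convolution_op nu f \in Lfun (@circle_measure R) q%:E].
Proof.
move=> [[p| |] [q [p1 pq hf]]] //; last by rewrite ltNge leey in pq.
case: q pq hf => [q| |] pq hf; last by rewrite ltNge leNye in pq.
  by exists p, q; rewrite -!lte_fin.
(* For [q] infinite any finite exponent above [p] will do, as the measure is finite. *)
rewrite lte_fin in p1; exists p, (p + 1); split => //; first lra.
move=> f /hf; apply: Lfun_subset; rewrite ?leey ?lee_fin//; first lra.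
by rewrite fin_num_measure.
Qed.

Lemma measurable_circle_translate (R : realType) (y : circle R) :
  measurable_fun [set: circle R] (fun x : circle R => x - y).
Proof.
move=> _ _ [B mB <-]; rewrite setTI.
have m : measurable_fun [set: circle R] (fun x => circle_val (x - y) : R).
  under [X in measurable_fun _ X]eq_fun do rewrite circle_valB.
  apply: measurableT_comp; first exact: measurable_frac_part.
  by apply: measurable_funB => //; exact: measurable_circle_val.
by have := m measurableT _ mB; rewrite !setTI.
Qed.

Lemma integral_circle_shift (R : realType) (y : circle R) (f : circle R -> \bar R) :
  measurable_fun [set: circle R] f -> (forall x, 0 <= f x)%E ->
  (\int[@circle_measure R]_x f (x - y)%R = \int[@circle_measure R]_x f x)%E.
Proof.
move=> mf f0.
have := @ge0_integral_pushforward _ _ _ _ R _ (@measurable_circle_translate R y)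
  (@circle_measure R) setT f measurableT mf (fun x _ => f0 x).
rewrite preimage_setT => <-; apply: eq_measure_integral.
  exact: measurable_circle_translate.
by move=> ? A mA _; exact: circle_measure_shift.
Qed.

Lemma measurable_circle_powR_sub (R : realType) (b : R) :
  measurable_fun [set: circle R * circle R]
    (fun z : circle R * circle R => (circle_val (z.1 - z.2) `^ b)%:E).
Proof.
apply/measurable_EFinP; under [X in measurable_fun _ X]eq_fun do rewrite circle_valB.
apply: (@measurableT_comp _ _ _ _ _ _ (fun z : R => z `^ b)).
  exact: measurable_powR.
apply: measurableT_comp; first exact: measurable_frac_part.
by apply: measurable_funB; apply: measurableT_comp => //; exact: measurable_circle_val.
Qed.

(* Needed because convolution_op is 0, not +oo, where the integral diverges. *)
Lemma ae_conv_powR_fin_num (R : realType) (nu : probability (circle R) R) (b : R) :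
  0 < b < 1 ->
  {ae (@circle_measure R), forall x,
    (\int[nu]_y (circle_val (x - y)%R `^ (- b))%R%:E)%E \is a fin_num}.
Proof.
move=> b01.
have mk := @measurable_circle_powR_sub R (- b).
have k0 (z : circle R * circle R) : (0 <= (circle_val (z.1 - z.2) `^ (- b))%:E)%E.
  by rewrite lee_fin powR_ge0.
have mF := measurable_fun_fubini_tonelli_F (m2 := nu) _ mk k0.
suff int : (@circle_measure R).-integrable setT
    (fun x => \int[nu]_y (circle_val (x - y)%R `^ (- b))%R%:E)%E.
  by have := integrable_ae measurableT int; apply: filterS => x; apply.
apply/integrableP; split; first exact: mF.
have F0 x : (0 <= \int[nu]_y (circle_val (x - y)%R `^ (- b))%R%:E)%E.
  by apply: integral_ge0 => y _; rewrite lee_fin powR_ge0.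
under eq_integral do rewrite gee0_abs ?F0//.
(* After Tonelli, translation invariance makes the inner integral independent of [y]. *)
have := fubini_tonelli (m1 := @circle_measure R) (m2 := nu) _ mk k0.
rewrite /= => ->.
under eq_integral => y _.
  rewrite (@integral_circle_shift R y (fun x => (circle_val x `^ (- b))%:E)); last 2 first.
  - by apply/measurable_EFinP; exact: measurable_circle_powR.
  - by move=> x; rewrite lee_fin powR_ge0.
  over.
rewrite integral_cst// [X in (_ * X)%E](_ : _ = 1%E) ?mule1; last exact: probability_setT.
exact: integral_circle_powR.
Qed.

Lemma circle_powR_Lfun (R : realType) (a p : R) : 0 < a -> 1 < p -> a * p < 1 ->
  (fun t : circle R => circle_val t `^ (- a)) \in Lfun (@circle_measure R) p%:E.
Proof.
move=> a0 p1 ap1; have p0 : 0 < p by lra.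
rewrite inE; apply/andP; split; rewrite inE/=; first exact: measurable_circle_powR.
rewrite /finite_norm unlock /Lnorm; apply: poweR_lty.
under eq_integral => t _.
  rewrite /= ger0_norm ?powR_ge0// -powRrM mulNr.
  over.
by apply: integral_circle_powR; rewrite ap1 mulr_gt0.
Qed.

Lemma Lfun_integral_lty (R : realType) (g : circle R -> R) (q : R) : 0 < q ->
  g \in Lfun (@circle_measure R) q%:E ->
  measurable_fun [set: circle R] g /\
  (\int[@circle_measure R]_x (`|g x| `^ q)%:E < +oo)%E.
Proof.
move=> q0; rewrite inE => /andP[]; rewrite !inE/= => mg; split => //.
have := @powR_Lnorm _ _ _ (@circle_measure R) (EFin \o g) q.
rewrite gt_eqF// => /(_ isT) /= <-.
by apply: poweR_lty.
Qed.

(** * Hoelder continuity of hyperbounded probabilities *)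

Lemma circle_valD (R : realType) (x y : circle R) :
  circle_val (x + y) = frac_part (circle_val x + circle_val y).
Proof. by []. Qed.

(** With [x] less than [r] ahead of [x0] and [y] less than [r] behind, [x - y] lies in [(0, 2r)];
    since [2r <= 1] there is no wrapping, and the integrand is at least [(2r)^(-a)]. *)
Lemma arc_convolution_le (R : realType) (nu : probability (circle R) R)
    (a r : R) (x0 x : circle R) :
  0 < a -> r <= 2^-1 -> 0 < circle_val (x - x0) < r ->
  (((2 * r) `^ (- a))%:E * nu (circle_arc r x0) <=
    \int[nu]_y (circle_val (x - y)%R `^ (- a))%R%:E)%E.
Proof.
move=> a0 r2 /andP[t0 tr].
have := @integral_indic _ _ R nu setT measurableT _ (@measurable_arc R r x0).
rewrite setIT => <-; rewrite -ge0_integralZl//; last 2 first.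
- by apply/measurable_EFinP; apply: measurable_indic; exact: measurable_arc.
- by rewrite lee_fin powR_ge0.
apply: ge0_le_integral => //.
- by move=> y _; rewrite mule_ge0// lee_fin// powR_ge0.
- apply: measurable_funeM.
  by apply/measurable_EFinP; apply: measurable_indic; exact: measurable_arc.
- apply/measurable_EFinP; apply: (@measurableT_comp _ _ _ _ _ _ (fun z : R => z `^ _)).
    exact: measurable_powR.
  exact: measurable_circle_sub.
move=> y _; rewrite -EFinM lee_fin indicE.
have [|_] := boolP (y \in circle_arc r x0); last by rewrite mulr0 powR_ge0.
rewrite inE /circle_arc mulr1 => yr; have /andP[s0 s1] := circle_valP (x0 - y).
have yr' : circle_val (x0 - y) < r by exact: yr.
have -> : circle_val (x - y) = circle_val (x - x0) + circle_val (x0 - y).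
  have -> : x - y = (x - x0) + (x0 - y) by rewrite addrA subrK.
  rewrite circle_valD; apply: frac_part_id; apply/andP.
  by move: (circle_val _) (circle_val _) s0 t0 tr yr' => u v; split; lra.
rewrite !powRN lef_pV2 ?posrE ?powR_gt0//; [|lra|lra].
by apply: ge0_ler_powR; rewrite ?nnegrE ?ltW//; lra.
Qed.

(** The pointwise lower bound on the convolution is raised to the power [q] and integrated over the
    arc of length [r] ahead of [x0]. *)
Lemma arc_powR_le (R : realType) (nu : probability (circle R) R)
    (a q r : R) (x0 : circle R) :
  0 < a < 1 -> 0 < q -> 0 < r <= 2^-1 ->
  let g := convolution_op nu (fun t => circle_val t `^ (- a)) in
  measurable_fun [set: circle R] g ->
  (r%:E * (((2 * r) `^ (- a) * fine (nu (circle_arc r x0))) `^ q)%:E <=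
    \int[@circle_measure R]_x (`|g x| `^ q)%:E)%E.
Proof.
move=> a01 q0 /andP[r0 r2] g mg.
pose X := (fun x : circle R => x - x0) @^-1` [set t : circle R | 0 < circle_val t < r].
set L := (_ `^ q)%R.
have mX : measurable X.
  rewrite /X -[X in measurable X]setTI; apply: measurable_circle_translate => //.
  exact: measurable_oarc0.
have muX : circle_measure X = r%:E.
  rewrite circle_measure_shift; last exact: measurable_oarc0.
  by apply: circle_measure_oarc0; lra.
rewrite muleC -muX.
have := @integral_indic _ _ R (@circle_measure R) setT measurableT _ mX.
rewrite setIT => <-; rewrite -ge0_integralZl//; last 2 first.
- by apply/measurable_EFinP; exact: measurable_indic.
- by rewrite lee_fin powR_ge0.
apply: ae_ge0_le_integral => //.
- by move=> y _; rewrite mule_ge0// lee_fin// powR_ge0.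
- by apply: measurable_funeM; apply/measurable_EFinP; exact: measurable_indic.
- apply/measurable_EFinP; apply: (@measurableT_comp _ _ _ _ _ _ (fun z : R => z `^ q)).
    exact: measurable_powR.
  exact: measurableT_comp.
(* [g x] equals the extended integral only where the latter is finite, hence a comparison almost
   everywhere. *)
have := @ae_conv_powR_fin_num R nu a a01; apply: filterS => x Gfin _.
rewrite -EFinM lee_fin indicE.
have [|_] := boolP (x \in X); last by rewrite mulr0 powR_ge0.
rewrite inE => xX; rewrite mulr1 /L.
have mnu : nu (circle_arc r x0) \is a fin_num.
  by rewrite fin_num_measure//; exact: measurable_arc.
have le : (2 * r) `^ (- a) * fine (nu (circle_arc r x0)) <= g x.
  rewrite -lee_fin EFinM fineK// /g /convolution_op /Rintegral fineK//.
  by apply: arc_convolution_le => //; case/andP: a01.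
have h0 : 0 <= (2 * r) `^ (- a) * fine (nu (circle_arc r x0)).
  by rewrite mulr_ge0 ?powR_ge0// fine_ge0.
apply: (ge0_ler_powR (ltW q0)); rewrite ?nnegrE//.
exact: le_trans le (ler_norm _).
Qed.

(** For an arc of length [r] and mass [b], [r ((2r)^(-a) b)^q <= A] gives [b^q <= M r^e] with
    [e = aq - 1]. *)
Lemma hyperbounded_arc_decay (R : realType) (nu : probability (circle R) R) :
  hyperbounded nu -> exists K C, arc_decay nu K C.
Proof.
move=> /hyperbounded_real[p [q [p1 pq hyp]]].
have p0 : 0 < p by lra.
have q0 : 0 < q by lra.
(* The midpoint gives both [a p < 1], for membership in [L^p], and [a q > 1], for a positive
   exponent [e]. *)
pose a := (p^-1 + q^-1) / 2.
have qp : q^-1 < p^-1 by rewrite ltf_pV2.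
have qi0 : 0 < q^-1 by rewrite invr_gt0.
have p11 : p^-1 < 1 by rewrite invf_lt1.
have a01 : 0 < a < 1 by rewrite /a; apply/andP; split; lra.
have [a0 a1] := andP a01.
have ap : a * p < 1 by rewrite -ltr_pdivlMr// mul1r /a; lra.
have aq : 1 < a * q by rewrite -ltr_pdivrMr// mul1r /a; lra.
have := hyp _ (@circle_powR_Lfun R a p a0 p1 ap).
move=> /(@Lfun_integral_lty R _ q q0)[].
set g := convolution_op _ _ => mg Afin.
pose A := fine (\int[@circle_measure R]_x (`|g x| `^ q)%:E).
have A0 : 0 <= A by apply: fine_ge0; apply: integral_ge0 => x _; rewrite lee_fin powR_ge0.
have AE : (\int[@circle_measure R]_x (`|g x| `^ q)%:E = A%:E)%E.
  rewrite fineK// ge0_fin_numE//; apply: integral_ge0 => x _.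
  by rewrite lee_fin powR_ge0.
pose e := a * q - 1; have e0 : 0 < e by rewrite subr_gt0.
(* [K e >= 4q] turns [r^e] with [r = j^-K] into at most [j^(-4q)]; [K >= 1] ensures [r <= 1/2] for
   [j >= 2]. *)
pose K := (Num.trunc (4 * q / e)).+1.
have Ke : 4 * q <= K%:R * e by rewrite -ler_pdivrMr// ltW// truncnS_gt.
pose M := A * 2 `^ (a * q).
have M0 : 0 <= M by rewrite mulr_ge0 ?powR_ge0.
(* The added 1 handles [j = 1], where [r = 1] is too long for the arc estimate and the bound 1 on
   the mass is used. *)
exists K, (M `^ q^-1 + 1) => j x0 j0.
have mnu : nu (circle_arc (j%:R ^+ K)^-1 x0) \is a fin_num.
  by rewrite fin_num_measure//; exact: measurable_arc.
have [j1|j1] := leqP j 1.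
  have -> : j = 1%N by apply/eqP; rewrite eqn_leq j1 j0.
  apply: (@le_trans _ _ 1%E); first by apply: probability_le1; exact: measurable_arc.
  by rewrite expr1n divr1 lee_fin lerDr powR_ge0.
set r := (_ ^+ K)^-1; have jp : 0 < j%:R :> R by rewrite ltr0n.
have jK0 : 0 < j%:R ^+ K :> R by rewrite exprn_gt0.
have r0 : 0 < r by rewrite invr_gt0.
have r2 : r <= 2^-1.
  rewrite lef_pV2 ?posrE// -natrX ler_nat.
  by rewrite (leq_trans j1)// -[leqLHS]expn1 leq_pexp2l.
have := @arc_powR_le R nu a q r x0 a01 q0 ltac:(by rewrite r0 r2) mg.
rewrite -/g AE -EFinM lee_fin; set b := fine _ => hb.
have b0 : 0 <= b by apply: fine_ge0.
rewrite -[nu _]fineK// lee_fin -/b.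
have rE : r = j%:R `^ (- K%:R) by rewrite powR_invn// ltW.
have re0 : 0 < r `^ e by exact: powR_gt0.
have c0 : 0 < 2 `^ (a * q) :> R by exact: powR_gt0.
have scale : (2 * r) `^ (a * q) = 2 `^ (a * q) * (r * r `^ e).
  rewrite powRM// ?ltW//; congr (_ * _).
  transitivity (r `^ 1 * r `^ e); last by rewrite powRr1// ltW.
  rewrite -powRD; last by rewrite (gt_eqF r0) implybT.
  by rewrite /e addrC subrK.
have bM : b `^ q <= M * r `^ e.
  move: hb; rewrite powRM ?powR_ge0// -powRrM mulNr powRN scale => hb.
  have := ler_wpM2l (ltW (mulr_gt0 c0 re0)) hb.
  rewrite (_ : _ * (r * _) = b `^ q); last by field; rewrite !gt_eqF.
  by rewrite /M; move/le_trans; apply; rewrite le_eqVlt; apply/orP; left; apply/eqP; ring.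
have bq : b `^ q <= M * (j%:R `^ (- 4%:R)) `^ q.
  apply: (le_trans bM); rewrite ler_wpM2l// rE -!powRrM ler_powR ?ler1n//.
  by rewrite !mulNr lerN2.
have qi : 0 <= q^-1 by exact: ltW.
have := ge0_ler_powR qi _ _ bq; rewrite !nnegrE !powR_ge0 mulr_ge0 ?powR_ge0//.
move=> /(_ isT isT); rewrite -powRrM mulfV ?gt_eqF// powRr1//.
rewrite powRM ?powR_ge0// -[X in _ <= _ * X]powRrM mulfV ?gt_eqF// powRr1 ?powR_ge0//.
rewrite (powR_invn _ (ltW jp)) => h; apply: (le_trans h).
by rewrite mulrDl mul1r lerDl invr_ge0 exprn_ge0// ltW.
Qed.

Theorem proposition6p15 (R : realType) (nu : probability (circle R) R) :
  hyperbounded nu ->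
  forall n : nat -> nat,
    (forall k, (0 < n k)%N) ->
    injective n ->
    (exists C : nat, forall k, `|(n k.+1)%:Z - (n k)%:Z| <= C%:Z) ->
    {ae nu, forall x : circle R,
      unif_dist_mod1 (fun k => (n k)%:R * circle_val x)}.
Proof.
move=> /hyperbounded_arc_decay[K [C dec]] n _ ninj gap.
exact: ae_unif_dist dec ninj gap.
Qed.
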